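(* Every graph in the $\mathrm{Y}\nabla\mathrm{Y}$ family of the complete graph $K_8$ belongs to $\mathcal{O}_3$; that is, each such graph is not $3$-apex, while every proper minor of it is $3$-apex.
   Context: All graphs are finite. A graph is $n$-apex if deleting $n$ or fewer of its vertices can result in a planar graph. $H$ is a minor of $G$ if $H$ can be obtained by contracting edges in a subgraph of $G$. $\mathcal{O}_n$ is the set of graphs that are not $n$-apex even though every proper minor is $n$-apex. A $\nabla\mathrm{Y}$ (triangle-Y) move on a graph deletes the three edges of a triangle $abc$ and then adds a new vertex $v$ together with the edges $av$, $bv$, $cv$. The reverse operation is a $\mathrm{Y}\nabla$ (Y-triangle) move: a degree-three vertex $v$ with neighbors $a,b,c$ is deleted and the edges $ab$, $ac$, $bc$ are added. The $\mathrm{Y}\nabla\mathrm{Y}$ family of a graph $G$ is the set of all graphs obtained from $G$ by a sequence of zero or more $\nabla\mathrm{Y}$ or $\mathrm{Y}\nabla$ moves. *)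

(* Defs.v *)
From HB Require Import structures.
From mathcomp Require Import all_boot all_order all_algebra.
From mathcomp Require Import all_classical all_reals all_analysis.
Set Implicit Arguments.
Unset Strict Implicit.
Unset Printing Implicit Defensive.
Import Order.TTheory GRing.Theory Num.Theory.
Import numFieldNormedType.Exports.

Record sgraph := SGraph {
  vertex :> finType;
  adj : rel vertex;
  adj_sym : symmetric adj;
  adj_irr : irreflexive adj
}.

Definition iso (G H : sgraph) : Prop :=
  exists f : G -> H, bijective f /\ forall x y : G, adj (f x) (f y) = adj x y.

Section Constructions.
Variable G : sgraph.

Definition edges : {set {set G}} :=
  [set e : {set G} | [exists x, exists y, adj x y && (e == [set x; y])]]%SET.

Section Delete.
Variable S : {set G}.
Definition delete_adj : rel {x : G | x \notin S} :=
  fun x y => adj (val x) (val y).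
Lemma delete_sym : symmetric delete_adj.
Proof. by move=> x y; rewrite /delete_adj adj_sym. Qed.
Lemma delete_irr : irreflexive delete_adj.
Proof. by move=> x; rewrite /delete_adj adj_irr. Qed.
Definition delete : sgraph := SGraph delete_sym delete_irr.
End Delete.

(* The edge uv is contracted onto u; loops and repeated edges are discarded. *)
Section Contract.
Variables u v : G.
Definition contract_adj : rel {x : G | x != v} :=
  fun x y => (val x != val y) &&
    [|| adj (val x) (val y),
        (val x == u) && adj v (val y) |
        (val y == u) && adj v (val x)].
Lemma contract_sym : symmetric contract_adj.
Proof.
move=> x y; rewrite /contract_adj eq_sym adj_sym.
by congr (_ && (_ || _)); rewrite orbC.
Qed.
Lemma contract_irr : irreflexive contract_adj.
Proof. by move=> x; rewrite /contract_adj eqxx. Qed.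
Definition contract : sgraph := SGraph contract_sym contract_irr.
End Contract.

(* [None] is the new vertex. *)
Section TriangleY.
Variables a b c : G.
Definition triangleY_adj : rel (option G) := fun x y =>
  match x, y with
  | Some x, Some y =>
      adj x y && ~~ ((x \in [:: a; b; c]) && (y \in [:: a; b; c]))
  | Some x, None | None, Some x => x \in [:: a; b; c]
  | None, None => false
  end.
Lemma triangleY_sym : symmetric triangleY_adj.
Proof. by move=> [x|] [y|] //=; rewrite adj_sym (andbC (x \in _)). Qed.
Lemma triangleY_irr : irreflexive triangleY_adj.
Proof. by move=> [x|] //=; rewrite adj_irr. Qed.
Definition triangleY : sgraph := SGraph triangleY_sym triangleY_irr.
End TriangleY.

Section YTriangle.
Variable v : G.
Definition Ytriangle_adj : rel {x : G | x != v} :=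
  fun x y => adj (val x) (val y) ||
    [&& val x != val y, adj v (val x) & adj v (val y)].
Lemma Ytriangle_sym : symmetric Ytriangle_adj.
Proof.
move=> x y; rewrite /Ytriangle_adj adj_sym eq_sym.
by congr (_ || (_ && _)); rewrite andbC.
Qed.
Lemma Ytriangle_irr : irreflexive Ytriangle_adj.
Proof. by move=> x; rewrite /Ytriangle_adj adj_irr eqxx. Qed.
Definition Ytriangle : sgraph := SGraph Ytriangle_sym Ytriangle_irr.
End YTriangle.

End Constructions.

Definition complete_adj n : rel 'I_n := fun i j => i != j.
Lemma complete_sym n : symmetric (@complete_adj n).
Proof. by move=> i j; rewrite /complete_adj eq_sym. Qed.
Lemma complete_irr n : irreflexive (@complete_adj n).
Proof. by move=> i; rewrite /complete_adj eqxx. Qed.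
Definition complete n : sgraph := SGraph (@complete_sym n) (@complete_irr n).

(* Graphs are considered up to isomorphism: the new vertices are named by the
   constructions above, hence the closure [YtriY_iso]. *)
Inductive YtriY_family (G : sgraph) : sgraph -> Prop :=
| YtriY_refl : YtriY_family G G
| YtriY_iso (H K : sgraph) : YtriY_family G H -> iso H K -> YtriY_family G K
| YtriY_triangleY (H : sgraph) (a b c : H) :
    YtriY_family G H -> adj a b -> adj a c -> adj b c ->
    YtriY_family G (triangleY a b c)
| YtriY_Ytriangle (H : sgraph) (v : H) :
    YtriY_family G H -> #|[set x | adj v x]%SET| = 3 ->
    YtriY_family G (Ytriangle v).

Definition subgraph (H G : sgraph) : Prop :=
  exists f : H -> G, injective f /\ forall x y, adj x y -> adj (f x) (f y).

Inductive contracts_to (G : sgraph) : sgraph -> Prop :=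
| contracts_iso (H : sgraph) : iso G H -> contracts_to G H
| contracts_edge (u v : G) (H : sgraph) :
    adj u v -> contracts_to (contract u v) H -> contracts_to G H.

Definition minor (H G : sgraph) : Prop :=
  exists2 K : sgraph, subgraph K G & contracts_to K H.

Definition proper_minor (H G : sgraph) : Prop := minor H G /\ ~ iso H G.

Local Open Scope classical_set_scope.
Local Open Scope ring_scope.

Definition arc_between (R : realType) (A : set (R * R)) (p q : R * R) : Prop :=
  exists g : R -> R * R,
    [/\ {within `[0, 1], continuous g},
        {in `[0, 1] &, injective g},
        g 0 = p, g 1 = q & A = g @` `[0, 1] ].

(* The inner part of an edge contains no vertex and no point of another edge. *)
Definition planar (R : realType) (G : sgraph) : Prop :=
  exists (pos : G -> R * R) (arc : {set G} -> set (R * R)),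
    [/\ injective pos,
        forall x y : G, adj x y ->
          arc_between (arc [set x; y]%SET) (pos x) (pos y),
        forall (e : {set G}) (x : G),
          e \in edges G -> arc e (pos x) -> x \in e &
        forall e f : {set G}, e \in edges G -> f \in edges G -> e != f ->
          forall p, arc e p -> arc f p ->
          exists2 x : G, x \in (e :&: f)%SET & p = pos x].

Definition apex (R : realType) (n : nat) (G : sgraph) : Prop :=
  exists2 S : {set G}, (#|S| <= n)%N & planar R (delete S).

Definition apex_obstruction (R : realType) (n : nat) (G : sgraph) : Prop :=
  ~ apex R n G /\ forall H : sgraph, proper_minor H G -> apex R n H.

(* Main.v *)
Require Import Defs.
From mathcomp Require Import all_boot all_order all_algebra.
From mathcomp Require Import boolp zify ring lra.
From Stdlib Require Import Btauto.
Set Implicit Arguments.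
Unset Strict Implicit.
Unset Printing Implicit Defensive.

(** The graphs of the family have a uniform shape.  The eight vertices of K_8
    are its points; every graph of the family consists of these points and of
    pairwise nonadjacent hubs, each joined to three points, in such a way that
    any two points are linked exactly once, by an edge or by a common hub
    ([full]).  A triangle contains no hub, because two of its vertices would be
    linked twice; so a triangle-Y move turns three links into a hub.  A point
    has degree at least four, because seven links leave it and an edge carries
    at most two of them; so a Y-triangle move turns a hub into three links.
    This gives [family_full], and both halves of the theorem hold for every
    full graph.

    A full graph is not 3-apex ([full_not_apex]).  Suppose that deleting a set S
    of at most three vertices leaves a plane drawing.  If S contains no hub,
    five points remain, and their links draw K_5 in such a way that disjoint
    edges have disjoint arcs.  If S contains k > 0 hubs, at least 5 + k points
    remain, and the only links lost are those through the k hubs; there are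
    still two triples of points with all nine links between them
    ([split_points]), and these draw K_{3,3}.  No such drawing exists
    ([K5_not_loosely_drawn], [K33_not_loosely_drawn]).  Indeed disjoint arcs
    are compact, hence at a positive distance, and the arcs can be replaced by
    polygonal chains in general position such that disjoint edges do not cross.
    But the number of crossings of disjoint edges is odd.  To see this, replace
    a chain by the segment between its ends: chain and segment form a closed
    polygon, which is crossed an even number of times by the edges disjoint
    from the given one, as these form a closed polygon too (a triangle in K_5,
    a quadrilateral in K_{3,3}).  So all edges may be taken straight
    ([total_crossing_straight]).  For five points the claim is then a statement
    about the signs of ten determinants ([crosses_K5]), and the case of K_{3,3}
    is a sum of instances of it ([crosses_K33]).

    A proper minor of a full graph is 3-apex ([proper_minor_apex]).  A proper
    subgraph lacks a point or a link.  Contracting an edge between a point and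
    a hub also loses a link, namely the one between the two other neighbours of
    the hub.  After the contraction of an edge between two points, one can
    delete the new vertex and two more points, which leaves at most four points;
    further contractions preserve this.  So one of two situations is reached
    ([subfull]), and in both the deletion of three vertices leaves a graph on
    at most five points, two of them unlinked if there are five, together with
    hubs.  Such a graph is a subgraph of [frame]: K_5 minus an edge is drawn
    with straight edges and triangular faces, and every hub is put into a face
    whose corners include its neighbours ([frame_planar]). *)

(** * Points, hubs and links *)

Definition nbhd (G : sgraph) (x : G) : {set G} := [set y | adj x y].

(** The vertices outside [Q] are the hubs.  [None] stands for an edge [xy], and
    [Some w] for a path [xwy] through a hub. *)
Definition link (G : sgraph) (Q : {set G}) (x y : G) (l : option G) : bool :=
  if l is Some w then [&& w \notin Q, adj w x & adj w y] else adj x y.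

Record singly_linked (G : sgraph) (Q : {set G}) : Prop := SinglyLinked {
  hub_indep : forall w w', w \notin Q -> w' \notin Q -> adj w w' = false;
  hub_deg : forall w, w \notin Q -> #|nbhd w| <= 3;
  link_uniq : forall x y l l', x \in Q -> y \in Q -> x != y ->
    link Q x y l -> link Q x y l' -> l = l' }.

Record full (G : sgraph) (Q : {set G}) : Prop := Full {
  full_singly_linked : singly_linked Q;
  full_card : #|Q| = 8;
  full_deg : forall w, w \notin Q -> #|nbhd w| = 3;
  full_link : forall x y, x \in Q -> y \in Q -> x != y ->
    exists l, link Q x y l }.

Lemma full_complete : full [set: complete 8].
Proof.
split; last by move=> x y _ _ xy; exists None.
- split; [by move=> w w'; rewrite inE|by move=> w; rewrite inE|].
  by move=> x y [w|] [w'|] _ _ _; rewrite /= ?inE.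
- by rewrite cardsT card_ord.
- by move=> w; rewrite inE.
Qed.

Lemma full_iso (G H : sgraph) (Q : {set G}) : full Q -> iso G H ->
  exists Q' : {set H}, full Q'.
Proof.
case=> [[indep deg uq] card deg3 lk] [f [bij_f fadj]].
have injf := bij_inj bij_f; have [g fK gK] := bij_f.
have gadj x y : adj (g x) (g y) = adj x y by rewrite -fadj !gK.
exists (f @: Q).
have mem_f x : (x \in f @: Q) = (g x \in Q) by rewrite -{1}(gK x) mem_imset.
have nb x : nbhd x = f @: nbhd (g x).
  by apply/setP => y; rewrite -{2}(gK y) mem_imset // !inE gadj.
have lkE x y l : link (f @: Q) x y l = link Q (g x) (g y) (omap g l).
  by case: l => [w|] /=; rewrite ?mem_f !gadj.
split; first split.
- by move=> w w'; rewrite !mem_f -gadj => /indep; apply.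
- by move=> w; rewrite mem_f nb card_imset // => /deg.
- move=> x y l l'; rewrite !mem_f !lkE => xQ yQ xy h h'.
  have : omap g l = omap g l'.
    by apply: uq h h' => //; apply: contra xy => /eqP/(can_inj gK)->.
  by move: (l) (l') => [w|] [w'|] //= [/(can_inj gK)->].
- by rewrite card_imset.
- by move=> w; rewrite mem_f nb card_imset // => /deg3.
- move=> x y; rewrite !mem_f => xQ yQ xy.
  have [|l h] := lk _ _ xQ yQ; first by apply: contra xy => /eqP/(can_inj gK)->.
  by exists (omap f l); rewrite lkE; move: h; case: (l) => [w|] //=; rewrite fK.
Qed.

Section Triangle.
Variables (G : sgraph) (Q : {set G}).

(** If [a] were a hub, then [b] and [c] would be points linked both by an edge
    and through [a]. *)
Lemma triangle_in_points a b c : singly_linked Q ->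
  adj a b -> adj a c -> adj b c -> a \in Q.
Proof.
case=> indep _ uq ab ac bc; apply/negPn/negP => aQ.
have bQ : b \in Q by apply/negPn/negP => bQ; rewrite indep in ab.
have cQ : c \in Q by apply/negPn/negP => cQ; rewrite indep in ac.
have bc' : b != c by apply: contraTneq bc => ->; rewrite adj_irr.
by have := uq b c None (Some a) bQ cQ bc' bc; rewrite /= aQ ab ac => /(_ isT).
Qed.

Lemma full_triangleY a b c : full Q -> adj a b -> adj a c -> adj b c ->
  full (Some @: Q : {set triangleY a b c}).
Proof.
move=> [lin card deg3 lk] ab ac bc; have [indep deg uq] := lin.
have aQ := triangle_in_points lin ab ac bc.
have bQ : b \in Q by apply: (triangle_in_points lin _ bc ac); rewrite adj_sym.
have cQ : c \in Q.
  by apply: (triangle_in_points lin _ _ ab); rewrite adj_sym.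
have abcQ x : x \in [:: a; b; c] -> x \in Q by rewrite !inE => /or3P[] /eqP->.
have abc_adj x y : x != y -> x \in [:: a; b; c] -> y \in [:: a; b; c] -> adj x y.
  move=> xy; rewrite !inE => xs ys; move: xy.
  by case/or3P: xs => /eqP->; case/or3P: ys => /eqP->; rewrite ?eqxx // adj_sym.
have someQ x : (Some x \in Some @: Q) = (x \in Q) by rewrite mem_imset //; exact: Some_inj.
have noneQ : None \notin Some @: Q by apply/negP => /imsetP[].
have hub_abc w : w \notin Q -> (w \in [:: a; b; c]) = false.
  by move=> wQ; apply/negbTE; apply: contra wQ => /abcQ.
have nbN : nbhd (None : triangleY a b c) = Some @: [set x in [:: a; b; c]].
  apply/setP => -[y|]; rewrite !inE /=; last by apply/esym/negP => /imsetP[].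
  by rewrite mem_imset ?inE //; exact: Some_inj.
have nbS w : w \notin Q -> nbhd (Some w : triangleY a b c) = Some @: nbhd w.
  move=> wQ; apply/setP => -[y|]; rewrite !inE /= hub_abc //.
    by rewrite andbT mem_imset ?inE //; exact: Some_inj.
  by apply/esym/negP => /imsetP[].
have cardN : #|nbhd (None : triangleY a b c)| = 3.
  rewrite nbN card_imset; last exact: Some_inj.
  rewrite cardsE; apply/card_uniqP; rewrite /= !inE negb_or andbT -andbA.
  have neq x y : adj x y -> x != y by apply: contraTneq => ->; rewrite adj_irr.
  by rewrite !neq.
have card_hub (w : triangleY a b c) : w \notin Some @: Q -> #|nbhd w| = 3.
  case: w => [w|//]; rewrite someQ => wQ; rewrite nbS // card_imset ?deg3 //.
  exact: Some_inj.
split; first split.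
- move=> [w|] [w'|]; rewrite ?someQ //= => wQ wQ'; last by rewrite hub_abc.
    by rewrite indep.
  by rewrite hub_abc.
- by move=> w /card_hub->.
- move=> [x|] [y|]; rewrite ?(negPf noneQ) // !someQ => l l' xQ yQ xy.
  have {}xy : x != y by apply: contra xy => /eqP->.
  have old k : link (Some @: Q : {set triangleY a b c}) (Some x) (Some y) k ->
     if k is Some None then (x \in [:: a; b; c]) && (y \in [:: a; b; c])
     else ~~ ((x \in [:: a; b; c]) && (y \in [:: a; b; c])) /\
          link Q x y (obind id k).
    case: k => [[w|]|] /=; rewrite ?someQ ?noneQ //; last by case/andP.
    case/and3P=> wQ; rewrite hub_abc // !andbT => wx wy; rewrite wQ wx wy.
    split=> //; apply/negP => /andP[xa ya].
    have := uq x y None (Some w) xQ yQ xy (abc_adj _ _ xy xa ya).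
    by rewrite /= wQ wx wy => /(_ isT).
  move=> /old h /old h'; case: l h => [[w|]|]; case: l' h' => [[w'|]|] //=;
    try by [move=> -> [] | move=> [] /negP nab _ /nab].
  + by move=> [_ h'] [_ h]; have [->] := uq x y (Some w) (Some w') xQ yQ xy h h'.
  + by move=> [_ h'] [_ h]; have := uq x y (Some w) None xQ yQ xy h h'.
  + by move=> [_ h'] [_ h]; have := uq x y None (Some w') xQ yQ xy h h'.
- exact: etrans (card_imset _ (@Some_inj _)) card.
- exact: card_hub.
- move=> [x|] [y|]; rewrite ?(negPf noneQ) // !someQ => xQ yQ xy.
  have [/andP[xa ya]|nab] := boolP ((x \in [:: a; b; c]) && (y \in [:: a; b; c])).
    by exists (Some None); rewrite /= noneQ xa ya.
  have [|[w|] h] := lk _ _ xQ yQ; first by apply: contra xy => /eqP->.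
    exists (Some (Some w)); case/and3P: h => wQ wx wy.
    by rewrite /= someQ wQ wx wy hub_abc.
  by exists None; move: h => /= ->.
Qed.

End Triangle.

Section Y.
Variables (G : sgraph) (Q : {set G}).

(** The links from [v] to the seven other points start with edges at [v], and
    an edge carries one link if it ends at a point, and two if it ends at a
    hub. *)
Lemma full_point_deg v : full Q -> v \in Q -> 3 < #|nbhd v|.
Proof.
move=> [[indep _ _] card deg3 lk] vQ.
(* The points to which the edge [vy] carries a link. *)
pose B y := if y \in Q then [set y] else nbhd y :\ v.
have cover7 : Q :\ v \subset cover [set B y | y in nbhd v].
  apply/subsetP => u; rewrite !inE => /andP[uv uQ]; rewrite eq_sym in uv.
  have [[w /and3P[wQ wv wu]|vu]] := lk _ _ vQ uQ uv.
    apply/bigcupP; exists (B w); first by rewrite imset_f // inE adj_sym.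
    by rewrite /B (negPf wQ) !inE eq_sym uv.
  apply/bigcupP; exists (B u); first by rewrite imset_f // inE.
  by rewrite /B uQ inE.
have B2 y : y \in nbhd v -> #|B y| <= 2.
  rewrite inE /B => vy; case: ifPn => yQ; first by rewrite cards1.
  by move: (deg3 _ yQ); rewrite (cardsD1 v) inE adj_sym vy add1n => -[->].
have : 7 <= 2 * #|nbhd v|.
  have <- : #|Q :\ v| = 7 by move: card; rewrite (cardsD1 v) vQ add1n => -[].
  apply: leq_trans (subset_leq_card cover7) _.
  apply: leq_trans (leq_card_cover _) _.
  apply: (@leq_trans (\sum_(A in [set B y | y in nbhd v]) 2)).
    by apply: leq_sum => A /imsetP[y /B2 By ->].
  by rewrite sum_nat_const mulnC leq_mul2l leq_imset_card.
by case: #|nbhd v| => [|[|[|[]]]].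
Qed.

Lemma full_Ytriangle v : full Q -> #|nbhd v| = 3 ->
  full [set x : Ytriangle v | val x \in Q].
Proof.
move=> fQ deg_v; have [lin card deg3 lk] := fQ; have [indep deg uq] := lin.
have vQ : v \notin Q.
  by apply/negP => /(full_point_deg fQ); rewrite deg_v.
have card_val (A : {set G}) : v \notin A ->
    #|[set x : Ytriangle v | val x \in A]| = #|A|.
  move=> vA; rewrite -(card_imset _ val_inj); apply: eq_card => x.
  apply/imsetP/idP => [[y]|xA]; first by rewrite inE => + ->.
  have xv : x != v by apply: contraNneq vA => <-.
  by exists (Sub x xv); rewrite ?inE ?SubK.
have nbE (w : Ytriangle v) : val w \notin Q ->
    nbhd w = [set x : Ytriangle v | val x \in nbhd (val w)].
  move=> wQ; apply/setP => y; rewrite !inE /= /Ytriangle_adj.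
  by rewrite (indep v (val w)) //= andbF orbF.
have vN w : w \notin Q -> v \notin nbhd w by move=> wQ; rewrite inE indep.
have card_hub (w : Ytriangle v) : val w \notin Q -> #|nbhd w| = 3.
  by move=> wQ; rewrite nbE // card_val ?deg3 // vN.
pose old (l : option (Ytriangle v)) (x y : G) : option G :=
  if l is Some w then Some (val w) else if adj x y then None else Some v.
have lkE (x y : Ytriangle v) l : x != y ->
    link [set x : Ytriangle v | val x \in Q] x y l ->
    link Q (val x) (val y) (old l (val x) (val y)).
  move=> xy; case: l => [w|] /=.
    rewrite !inE => /and3P[wQ]; rewrite /Ytriangle_adj !(indep v (val w)) //=.
    rewrite !andbF !orbF.
    by rewrite wQ => -> ->.
  rewrite /Ytriangle_adj; case: ifP => //= _ /and3P[_ vx vy].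
  by rewrite vQ vx vy.
split; first split.
- move=> w w'; rewrite !inE => wQ wQ' /=.
  rewrite /Ytriangle_adj (indep (val w)) // (indep v (val w)) //=.
  by rewrite andbF.
- by move=> w; rewrite inE => /card_hub->.
- move=> x y l l'; rewrite !inE => xQ yQ xy /(lkE _ _ _ xy) h /(lkE _ _ _ xy) h'.
  have := uq _ _ _ _ xQ yQ xy h h'.
  case: (l) (l') => [w|] [w'|] //=; first by move=> [/val_inj->].
    by case: ifP => // _ [wv]; have := valP w; rewrite /= wv eqxx.
  by case: ifP => // _ [wv]; have := valP w'; rewrite /= -wv eqxx.
- by rewrite card_val.
- by move=> w; rewrite inE => /card_hub.
- move=> x y; rewrite !inE => xQ yQ xy.
  have [[w /and3P[wQ wx wy]|h]] := lk _ _ xQ yQ xy; last first.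
    by exists None; move: h; rewrite /= /Ytriangle_adj => ->.
  have [wv|wv] := eqVneq w v.
    move: wx wy; rewrite wv => wx wy.
    by exists None; rewrite /= /Ytriangle_adj wx wy xy orbT.
  exists (Some (Sub w wv)); rewrite /= inE SubK wQ /Ytriangle_adj !SubK.
  by rewrite wx wy.
Qed.

End Y.

Lemma family_full (G : sgraph) : YtriY_family (complete 8) G ->
  exists Q : {set G}, full Q.
Proof.
elim=> [|H K _ [Q fQ] HK|H a b c _ [Q fQ] ab ac bc|H v _ [Q fQ] deg_v].
- by exists [set: complete 8]; exact: full_complete.
- exact: full_iso fQ HK.
- by exists (Some @: Q); exact: full_triangleY.
- by exists [set x : Ytriangle v | val x \in Q]; exact: full_Ytriangle.
Qed.

(** * Contractions and subgraphs of full graphs *)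

Definition deficient (G : sgraph) (Q : {set G}) : Prop :=
  #|Q| < 8 \/ exists x y, [/\ x \in Q, y \in Q, x != y & forall l, ~~ link Q x y l].

(** Outside [S] there are at most four points and independent hubs, at most one
    of which sees three points.  The hubs may share pairs of neighbours, as
    they do after contractions: any number of hubs with two neighbours can be
    drawn along an edge. *)
Record four_core (G : sgraph) (S Q : {set G}) : Prop := FourCore {
  four_core_indep : forall w w', w \notin S :|: Q -> w' \notin S :|: Q -> adj w w' = false;
  four_core_card : #|Q| <= 4;
  four_core_deg : forall w, w \notin S :|: Q -> #|nbhd w :&: Q| <= 3;
  four_core_uniq : forall w w', w \notin S :|: Q -> w' \notin S :|: Q ->
    2 < #|nbhd w :&: Q| -> 2 < #|nbhd w' :&: Q| -> w = w' }.

(** The two situations to which the proper minors of full graphs belong. *)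
Definition subfull (G : sgraph) : Prop :=
  (exists S Q : {set G}, #|S| <= 3 /\ four_core S Q) \/
  (exists Q : {set G}, [/\ singly_linked Q, #|Q| <= 8 & deficient Q]).

Lemma setU_setD (T : finType) (A B : {set T}) : A :|: B :\: A = A :|: B.
Proof. by apply/setP => x; rewrite !inE; case: (x \in A). Qed.

(** Among four points, two triples have two points in common; so two hubs that
    see three points each would link a pair twice. *)
Lemma singly_linked_four_core (G : sgraph) (S Q : {set G}) : singly_linked Q -> S \subset Q ->
  #|Q :\: S| <= 4 -> four_core S (Q :\: S).
Proof.
case=> indep deg uq SQ card4.
have hub w : w \notin S :|: Q :\: S -> w \notin Q.
  by rewrite setU_setD (setUidPr SQ).
split=> //.
- by move=> w w' /hub wQ /hub; exact: indep.
- by move=> w /hub /deg; apply: leq_trans; rewrite subset_leq_card ?subsetIl.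
- move=> w w' /hub wQ /hub wQ' w3 w3'.
  have : 1 < #|(nbhd w :&: (Q :\: S)) :&: (nbhd w' :&: (Q :\: S))|.
    have U4 : #|nbhd w :&: (Q :\: S) :|: nbhd w' :&: (Q :\: S)| <= 4.
      by apply: leq_trans card4; rewrite subset_leq_card // subUset !subsetIr.
    move: (cardsUI (nbhd w :&: (Q :\: S)) (nbhd w' :&: (Q :\: S))) w3 w3' U4; lia.
  case/card_gt1P => x [y [+ + xy]].
  rewrite !inE => /andP[/andP[wx /andP[_ xQ]] /andP[wx' _]].
  case/andP=> /andP[wy /andP[_ yQ]] /andP[wy' _].
  have := uq x y (Some w) (Some w') xQ yQ xy.
  by rewrite /= wQ wQ' wx wy wx' wy' => /(_ isT isT)[].
Qed.

(** Describing a contraction by its quotient map makes it symmetric in [u] and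
    [v], so that either end of the edge may be the hub. *)
Record contraction (G H : sgraph) (pi : G -> H) (u v : G) : Prop := Contraction {
  pi_uv : pi u = pi v;
  pi_fiber : forall x y, pi x = pi y -> x != y -> (x == u) && (y == v) || (x == v) && (y == u);
  pi_onto : forall h, exists x, pi x = h;
  pi_adj : forall x y, adj (pi x) (pi y) ->
    exists x' y', [/\ pi x' = pi x, pi y' = pi y & adj x' y'] }.

Lemma contractionC (G H : sgraph) (pi : G -> H) u v :
  contraction pi u v -> contraction pi v u.
Proof. by case=> ? fib ? ?; split=> // x y; rewrite orbC; exact: fib. Qed.

Lemma contract_contraction (G : sgraph) (u v : G) : adj u v ->
  exists pi : G -> contract u v, contraction pi u v.
Proof.
move=> uv; have u_v : u != v by apply: contraTneq uv => ->; rewrite adj_irr.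
pose u' : contract u v := Sub u u_v.
have piE x : val (insubd u' x) = if x == v then u else x.
  by rewrite val_insubd /=; case: eqP.
exists (insubd u'); split.
- by apply: val_inj; rewrite !piE eqxx (negPf u_v).
- move=> x y /(congr1 val); rewrite !piE.
  case: (eqVneq x v) => [->|xv]; case: (eqVneq y v) => [->|yv].
  + by [].
  + by move=> <- _; rewrite !eqxx ?orbT.
  + by move=> -> _; rewrite ?eqxx.
  + by move=> ->; rewrite eqxx.
- by move=> h; exists (val h); apply: val_inj; rewrite piE (negPf (valP h)).
- move=> x y; rewrite /= /contract_adj => /andP[_].
  set x' := insubd u' x; set y' := insubd u' y.
  have can z : insubd u' (val z) = z by apply: val_inj; rewrite piE (negPf (valP z)).
  have vu : insubd u' v = u' by apply: val_inj; rewrite piE eqxx.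
  case/or3P => [xy|/andP[/eqP xu vy]|/andP[/eqP yu vx]].
  + by exists (val x'), (val y'); rewrite !can.
  + by exists v, (val y'); rewrite can vu; split=> //; exact: val_inj.
  + exists (val x'), v; rewrite can vu adj_sym; split=> //; exact: val_inj.
Qed.

Section Contract.
Variables (G H : sgraph) (pi : G -> H) (u v : G).
Hypothesis piC : contraction pi u v.
Hypothesis uv : adj u v.

(** An edge outside [S] has an end in [Q], so a vertex outside the images of
    [S] and [Q] is an unmerged hub.  It has no more neighbours among the new
    points than it had among the old ones. *)
Lemma four_core_contract (S Q : {set G}) : four_core S Q ->
  four_core (pi @: S) (pi @: Q :\: pi @: S).
Proof.
case=> indep card deg uq.
have hub h : h \notin pi @: S :|: pi @: Q :\: pi @: S ->
    exists2 w, w \notin S :|: Q & h = pi w /\ forall z, pi z = h -> z = w.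
  rewrite setU_setD => hn.
  have {hn} hn z : pi z = h -> z \notin S :|: Q.
    by move=> zh; apply: contra hn; rewrite -imsetU -zh => /imset_f.
  have [w wh] := pi_onto piC h; exists w; first exact: hn.
  split=> // z zh; apply/eqP/negPn/negP => zw.
  have := pi_fiber piC (etrans zh (esym wh)) zw.
  have := indep _ _ (hn _ zh) (hn _ wh).
  by move=> zw0 /orP[]/andP[/eqP zu /eqP wv]; move: zw0; rewrite zu wv ?uv // adj_sym uv.
have nb w : w \notin S :|: Q -> (forall z, pi z = pi w -> z = w) ->
    #|nbhd (pi w) :&: (pi @: Q :\: pi @: S)| <= #|nbhd w :&: Q|.
  move=> wSQ fw; apply: leq_trans (leq_imset_card pi _); apply: subset_leq_card.
  apply/subsetP => h; rewrite !inE => /and3P[+ + _].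
  have [y <-] := pi_onto piC h => /(pi_adj piC)[w' [y' [/fw-> yy wy]]] hS.
  rewrite -yy; apply: imset_f; rewrite !inE wy /=.
  apply: contraTT wy => yQ; rewrite indep // !inE negb_or yQ andbT.
  by apply: contra hS => yS; rewrite -yy imset_f.
split.
- move=> h h' /hub[w wSQ [-> fw]] /hub[w' wSQ' [-> fw']].
  apply/negP => /(pi_adj piC)[x [y [/fw-> /fw'->]]].
  by rewrite indep.
- apply: leq_trans card; apply: leq_trans (leq_imset_card pi _).
  by rewrite subset_leq_card // subsetDl.
- by move=> h /hub[w wSQ [-> /(nb _ wSQ) le]]; apply: leq_trans le (deg _ wSQ).
- move=> h h' /hub[w wSQ [-> fw]] /hub[w' wSQ' [-> fw']] w3 w3'.
  congr pi; apply: uq => //; apply: leq_trans (nb _ _ _) => //.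
Qed.

Section Hub.
Variable Q : {set G}.
Hypotheses (linQ : singly_linked Q) (uQ : u \in Q) (vQ : v \notin Q).

Lemma point_fiber x y : x \in Q -> pi y = pi x -> y = x \/ x = u /\ y = v.
Proof.
move=> xQ yx; have [->|ne] := eqVneq y x; [by left|right].
have /orP[/andP[_ /eqP xv]|/andP[/eqP-> /eqP->]//] := pi_fiber piC yx ne.
by rewrite xv (negPf vQ) in xQ.
Qed.

Lemma hub_contract h : h \notin pi @: Q ->
  exists2 w, w \notin Q & [/\ w != v, h = pi w & forall z, pi z = h -> z = w].
Proof.
move=> hQ; have notQ z : pi z = h -> z \notin Q /\ z != v.
  move=> zh; split; apply: contra hQ; rewrite -zh; first exact: imset_f.
  by move/eqP->; rewrite -(pi_uv piC) imset_f.
have [w wh] := pi_onto piC h; have [wQ wv] := notQ _ wh.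
exists w => //; split=> // z zh; apply/eqP/negPn/negP => zw; have [zQ zv] := notQ _ zh.
have := pi_fiber piC (etrans zh (esym wh)) zw.
by rewrite (negPf wv) (negPf zv) andbF.
Qed.

(** Contracting the hub [v] into the point [u] replaces the two-step links from
    [u] through [v] by edges and drops the third link through [v]; the other
    links stay. *)
Lemma link_contract x y l' : x \in Q -> y \in Q -> x != y ->
  link (pi @: Q) (pi x) (pi y) l' ->
  exists2 l, link Q x y l &
    if l is Some w then
      if w == v then l' = None /\ (x = u \/ y = u) else l' = Some (pi w)
    else l' = None.
Proof.
have [indep deg uq] := linQ; move=> xQ yQ xy; case: l' => [h|] /=.
  case/and3P => /hub_contract[w wQ [wv -> fw]] wx wy.
  exists (Some w); last by rewrite (negPf wv).
  have point_nbr z : z \in Q -> adj (pi w) (pi z) -> adj w z.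
    move=> zQ /(pi_adj piC)[w' [z' [/fw-> /(point_fiber zQ)[->|[_ ->]]]]] //.
    by rewrite indep.
  by rewrite /= wQ !point_nbr.
move=> /(pi_adj piC)[x' [y' [/(point_fiber xQ) xx' /(point_fiber yQ) yy' x'y']]].
case: xx' x'y' => [->|[xu ->]].
  case: yy' => [-> xy'|[yu -> xv]]; first by exists None.
  exists (Some v); last by rewrite eqxx; split=> //; right.
  by rewrite /= vQ adj_sym xv yu adj_sym uv.
case: yy' => [->|[_ ->]]; last by rewrite adj_irr.
move=> vy; exists (Some v); last by rewrite eqxx; split=> //; left.
by rewrite /= vQ xu adj_sym uv.
Qed.

Lemma singly_linked_contract : singly_linked (pi @: Q).
Proof.
have [indep deg uq] := linQ; split.
- move=> h h' /hub_contract[w wQ [_ -> fw]] /hub_contract[w' wQ' [_ -> fw']].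
  by apply/negP => /(pi_adj piC)[x [y [/fw-> /fw'->]]]; rewrite indep.
- move=> h /hub_contract[w wQ [_ -> fw]].
  apply: leq_trans (deg _ wQ); apply: leq_trans (leq_imset_card pi _).
  apply: subset_leq_card; apply/subsetP => h'; rewrite inE.
  have [y <-] := pi_onto piC h' => /(pi_adj piC)[w' [y' [/fw-> <- wy]]].
  by apply: imset_f; rewrite inE.
- move=> _ _ l1 l2 /imsetP[x xQ ->] /imsetP[y yQ ->] pxy.
  have xy : x != y by apply: contra pxy => /eqP->.
  move=> /(link_contract xQ yQ xy)[k1 h1 +] /(link_contract xQ yQ xy)[k2 h2].
  rewrite (uq _ _ _ _ xQ yQ xy h1 h2); case: k2 {h1 h2} => [w|-> ->//].
  by case: eqP => _ => [[-> _] [-> _]|-> ->].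
Qed.

(** In a full graph the link between the other two neighbours of [v] is lost. *)
Lemma deficient_contract :
  deficient Q \/ full Q -> #|Q| <= 8 -> deficient (pi @: Q).
Proof.
have [indep deg uq] := linQ; move=> dfQ card8.
have inj x y : x \in Q -> y \in Q -> x != y -> pi x != pi y.
  move=> xQ yQ; apply: contra => /eqP /(point_fiber yQ)[->//|[_ xv]].
  by rewrite xv (negPf vQ) in xQ.
case: dfQ => [[lt8|[x [y [xQ yQ xy unl]]]]|[_ _ deg3 _]].
- by left; apply: leq_ltn_trans (leq_imset_card pi _) lt8.
- right; exists (pi x), (pi y); split; rewrite ?imset_f ?inj // => l'.
  by apply/negP => /(link_contract xQ yQ xy)[l]; rewrite (negPf (unl l)).
- have : 1 < #|nbhd v :\ u|.
    by move: (deg3 _ vQ); rewrite (cardsD1 u) inE adj_sym uv add1n => -[->].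
  case/card_gt1P => x [y [+ + xy]]; rewrite !inE => /andP[xu vx] /andP[yu vy].
  have nQ z : adj v z -> z \in Q by apply: contraTT => zQ; rewrite indep.
  have [xQ yQ] := (nQ _ vx, nQ _ vy).
  right; exists (pi x), (pi y); split; rewrite ?imset_f ?inj // => l'.
  apply/negP => /(link_contract xQ yQ xy)[l hl].
  have -> : l = Some v by apply: uq hl _ => //=; rewrite vQ vx vy.
  by rewrite eqxx => -[_ [/eqP|/eqP]]; rewrite ?(negPf xu) ?(negPf yu).
Qed.

End Hub.
End Contract.

Lemma subset_card_exists (T : finType) (A : {set T}) k :
  exists2 B : {set T}, B \subset A & #|B| = minn k #|A|.
Proof.
exists [set x in take k (enum A)].
  by apply/subsetP => x; rewrite inE => /mem_take; rewrite mem_enum.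
rewrite cardsE; have /card_uniqP -> : uniq (take k (enum A)).
  by rewrite take_uniq ?enum_uniq.
by rewrite size_take_min -cardE.
Qed.

(** If [u] and [v] are points, then [S] consists of [u], [v] and two more
    points, and the contraction makes three vertices of these four. *)
Lemma contract_singly_linked (G : sgraph) (Q : {set G}) (u v : G) :
  singly_linked Q -> #|Q| <= 8 -> deficient Q \/ full Q -> adj u v ->
  subfull (contract u v).
Proof.
move=> linQ card8 dfQ uv; have [pi piC] := contract_contraction uv.
have [indep _ _] := linQ; have vu : adj v u by rewrite adj_sym.
have [uQ|uQ] := boolP (u \in Q); have [vQ|vQ] := boolP (v \in Q).
- left; have u_v : u != v by apply: contraTneq uv => ->; rewrite adj_irr.
  have uvQ : [set u; v] \subset Q by rewrite subUset !sub1set uQ.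
  have [B BQ cardB] := subset_card_exists (Q :\: [set u; v]) 2.
  pose S := [set u; v] :|: B.
  have BQ' : B \subset Q by apply: subset_trans BQ (subsetDl _ _).
  have SQ : S \subset Q by rewrite subUset uvQ.
  have cardS : #|S| = 2 + #|B|.
    rewrite cardsU cards2 u_v; suff -> : [set u; v] :&: B = set0 by rewrite cards0 subn0.
    apply/eqP; rewrite setI_eq0 disjoint_sym.
    by apply: disjointWl BQ _; rewrite disjoints_subset setDE subsetIr.
  have cardQ : #|Q :\: [set u; v]| = #|Q| - 2 by rewrite cardsDS // cards2 u_v.
  have card4 : #|Q :\: S| <= 4.
    by rewrite cardsDS // cardS cardB cardQ; move: card8; lia.
  exists (pi @: S), (pi @: (Q :\: S) :\: pi @: S); split.
    have : #|pi @: (S :\ v)| <= #|S :\ v| := leq_imset_card _ _.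
    have -> : pi @: (S :\ v) = pi @: S.
      apply/eqP; rewrite eqEsubset imsetS ?subD1set //=.
      apply/subsetP => _ /imsetP[x xS ->]; have [->|xv] := eqVneq x v.
        by rewrite -(pi_uv piC) imset_f // !inE u_v eqxx.
      by rewrite imset_f // in_setD1 xv.
    rewrite [#|S :\ v|](_ : _ = #|S|.-1); last first.
      by rewrite (cardsD1 v S) !inE eqxx orbT.
    by rewrite cardS cardB => /leq_trans; apply; lia.
  by have := four_core_contract piC uv (singly_linked_four_core linQ SQ card4).
- right; exists (pi @: Q); split; first by have := singly_linked_contract piC uv linQ uQ vQ.
    exact: leq_trans (leq_imset_card _ _) card8.
  by have := deficient_contract piC uv linQ uQ vQ dfQ card8.
- have piC' := contractionC piC.
  right; exists (pi @: Q); split; first by have := singly_linked_contract piC' vu linQ vQ uQ.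
    exact: leq_trans (leq_imset_card _ _) card8.
  by have := deficient_contract piC' vu linQ vQ uQ dfQ card8.
- by rewrite indep in uv.
Qed.

Lemma contract_subfull (G : sgraph) (u v : G) : subfull G -> adj u v ->
  subfull (contract u v).
Proof.
case=> [[S [Q [card3 coreQ]]]|[Q [linQ card8 dQ]]] uv; last first.
  exact: contract_singly_linked linQ card8 (or_introl dQ) uv.
have [pi piC] := contract_contraction uv.
left; exists (pi @: S), (pi @: Q :\: pi @: S); split.
  exact: leq_trans (leq_imset_card _ _) card3.
by have := four_core_contract piC uv coreQ.
Qed.

Lemma contracts_to_subfull (G H : sgraph) : contracts_to G H -> subfull G ->
  exists2 H', subfull H' & iso H' H.
Proof.
elim=> {G H} [G H GH redG|G u v H uv _ IH redG]; first by exists G.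
by apply: IH; exact: contract_subfull.
Qed.

Lemma iso_sym (G H : sgraph) : iso G H -> iso H G.
Proof.
case=> f [[g fK gK] fadj]; exists g; split; first by exists f.
by move=> x y; rewrite -fadj !gK.
Qed.

Lemma iso_trans (G H K : sgraph) : iso G H -> iso H K -> iso G K.
Proof.
case=> f [bf fadj] [g [bg gadj]]; exists (g \o f); split; first exact: bij_comp.
by move=> x y; rewrite /= gadj fadj.
Qed.

Section Subgraph.
Variables (K G : sgraph) (f : K -> G) (Q : {set G}).
Hypotheses (f_inj : injective f) (f_adj : forall x y, adj x y -> adj (f x) (f y)).

Lemma link_subgraph x y l :
  link (f @^-1: Q) x y l -> link Q (f x) (f y) (omap f l).
Proof.
case: l => [w|] /=; last exact: f_adj.
by rewrite inE => /and3P[-> /f_adj-> /f_adj->].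
Qed.

Lemma singly_linked_subgraph : singly_linked Q -> singly_linked (f @^-1: Q).
Proof.
case=> indep deg uq; split.
- move=> w w'; rewrite !inE => wQ wQ'.
  by apply/negP => /f_adj; rewrite indep.
- move=> w; rewrite inE => /deg; apply: leq_trans.
  rewrite -(card_imset _ f_inj); apply: subset_leq_card; apply/subsetP.
  by move=> _ /imsetP[y + ->]; rewrite !inE => /f_adj.
- move=> x y l l'; rewrite !inE => xQ yQ xy /link_subgraph h /link_subgraph h'.
  have fxy : f x != f y by rewrite inj_eq.
  have := uq _ _ _ _ xQ yQ fxy h h'.
  by move=> {h h'}; case: l => [w|]; case: l' => [w'|] //= [/f_inj->].
Qed.

Lemma card_subgraph : #|f @^-1: Q| <= #|Q|.
Proof.
rewrite -(card_imset _ f_inj); apply: subset_leq_card.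
by apply/subsetP => _ /imsetP[x + ->]; rewrite inE.
Qed.

(** What a proper subgraph lacks is a point, a hub or an edge, and each hub and
    each edge carries a link that nothing replaces. *)
Lemma full_subgraph : full Q -> iso K G \/ deficient (f @^-1: Q).
Proof.
case=> linQ card8 deg3 lk; have [indep deg uq] := linQ.
have missing x y l : f x \in Q -> f y \in Q -> x != y -> link Q (f x) (f y) l ->
    (forall l', link (f @^-1: Q) x y l' -> omap f l' <> l) -> deficient (f @^-1: Q).
  move=> xQ yQ xy h no; right; exists x, y; split; rewrite ?inE // => l'.
  apply/negP => /[dup] /no + /link_subgraph h'; apply.
  by apply: uq h' h => //; rewrite inj_eq.
have points w : w \notin Q -> forall y, adj w y -> y \in Q.
  by move=> wQ y; apply: contraTT => yQ; rewrite indep.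
have other w y : w \notin Q -> adj w y -> exists2 z, adj w z & z != y.
  move=> wQ wy; have := deg3 _ wQ; rewrite (cardsD1 y) inE wy add1n => -[c2].
  have /card_gt0P[z] : 0 < #|nbhd w :\ y| by rewrite c2.
  by rewrite !inE => /andP[zy wz]; exists z.
have lost_point h : h \in Q -> (forall x, f x <> h) -> deficient (f @^-1: Q).
  move=> hQ no; left; rewrite -card8 -(card_imset _ f_inj); apply: proper_card.
  apply/properP; split; first by apply/subsetP => _ /imsetP[x + ->]; rewrite inE.
  by exists h => //; apply/imsetP => -[x _ /esym/no].
have [onto|/existsNP[h /forallNP no]] := pselect (forall h, exists x, f x = h); last first.
  right; have [hQ|hQ] := boolP (h \in Q); first exact: lost_point hQ no.
  have /card_gt0P[y] : 0 < #|nbhd h| by rewrite deg3.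
  rewrite inE => hy; have [z hz zy] := other _ _ hQ hy.
  have [[x xy]|/forallNP noy] := pselect (exists x, f x = y); last first.
    exact: lost_point (points _ hQ _ hy) noy.
  have [[x' xz]|/forallNP noz] := pselect (exists x, f x = z); last first.
    exact: lost_point (points _ hQ _ hz) noz.
  apply: (missing x x' (Some h)); rewrite ?xy ?xz ?(points _ hQ) //.
  - by apply: contra zy => /eqP xx; rewrite -xy -xz xx.
  - by rewrite /= hQ hy hz.
  - by move=> [w|] //= _ [/no].
have [refl|/existsNP[x /existsNP[y /not_implyP[fxy nxy]]]] :=
  pselect (forall x y, adj (f x) (f y) -> adj x y).
  left; exists f; split; last by move=> x y; apply/idP/idP => [/refl|/f_adj].
  have /choice[g gK] : forall h, exists x, f x = h by [].
  by exists g => // x; apply: f_inj; rewrite gK.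
right.
have hub_case a b : f a \notin Q -> adj (f a) (f b) -> ~ adj a b -> deficient (f @^-1: Q).
  move=> aQ fab nab; have [z az zb] := other _ _ aQ fab; have [c cz] := onto z.
  apply: (missing b c (Some (f a))); rewrite ?cz ?(points _ aQ) //.
  - by apply: contra zb => /eqP bc; rewrite -cz bc.
  - by rewrite /= aQ fab az.
  - by move=> [w|] //= /and3P[_ wb _] [/f_inj wa]; apply: nab; rewrite -wa.
have [xQ|xQ] := boolP (f x \in Q); last exact: hub_case xQ fxy nxy.
have [yQ|yQ] := boolP (f y \in Q); last first.
  by apply: (hub_case y x) => //; rewrite adj_sym.
apply: (missing x y None) => //; first by apply: contraTneq fxy => ->; rewrite adj_irr.
by move=> [w|] //= /nxy.
Qed.
End Subgraph.

Theorem proper_minor_subfull (G H : sgraph) (Q : {set G}) : full Q ->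
  proper_minor H G -> exists2 H', subfull H' & iso H' H.
Proof.
move=> fQ [[K [f [f_inj f_adj]] KH] niso].
have linG := full_singly_linked fQ.
have [KG|def] := full_subgraph f_inj f_adj fQ; last first.
  apply: contracts_to_subfull KH _; right; exists (f @^-1: Q); split=> //.
    exact: singly_linked_subgraph.
  by rewrite -(full_card fQ) card_subgraph.
have [Q' fQ'] := full_iso fQ (iso_sym KG).
case: KH niso => [H' KH'|u v H' uv KH'] niso.
  by case: niso; apply: iso_trans KG; exact: iso_sym.
apply: contracts_to_subfull KH' _.
apply: (contract_singly_linked (full_singly_linked fQ') _ _ uv); last by right.
by rewrite (full_card fQ').
Qed.

(** * Nine links that survive the deletion of hubs *)

Lemma set_between (T : finType) (D U : {set T}) n : D \subset U -> #|D| <= n <= #|U| ->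
  exists A : {set T}, [/\ D \subset A, A \subset U & #|A| = n].
Proof.
move=> DU /andP[Dn nU]; have [B BU cardB] := subset_card_exists (U :\: D)%SET (n - #|D|).
exists (D :|: B)%SET; split; first exact: subsetUl.
  by rewrite subUset DU (subset_trans BU (subsetDl _ _)).
rewrite cardsU (_ : (D :&: B = set0)%SET) ?cards0 ?subn0.
  by rewrite cardB cardsDS //; lia.
apply/eqP; rewrite setI_eq0 disjoint_sym disjoints_subset.
by rewrite (subset_trans BU) // setDE subsetIr.
Qed.

Section Split.
Variables (G : sgraph) (Q S : {set G}).
Hypotheses (fQ : full Q) (S3 : #|S| <= 3).

Lemma block_points w : w \notin Q -> nbhd w \subset Q.
Proof.
move=> wQ; apply/subsetP => x; rewrite inE.
by apply: contraTT => xQ; rewrite (hub_indep (full_singly_linked fQ)).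
Qed.

Lemma blocks_meet w w' : w \notin Q -> w' \notin Q -> w != w' ->
  #|nbhd w :&: nbhd w'| <= 1.
Proof.
move=> wQ wQ' ww'; rewrite leqNgt; apply/negP => /card_gt1P[x [y []]].
rewrite !inE => /andP[wx wx'] /andP[wy wy'] xy; case/eqP: ww'.
have xQ := subsetP (block_points wQ) x; rewrite inE in xQ.
have yQ := subsetP (block_points wQ) y; rewrite inE in yQ.
suff [] : Some w = Some w' by [].
apply: (link_uniq (full_singly_linked fQ)) (xQ wx) (yQ wy) xy _ _.
  by rewrite /= wQ wx wy.
by rewrite /= wQ' wx' wy'.
Qed.

(** It suffices to find three points [A] and a set [C] of at most 2 + k points
    that contains [A] and, up to deleted points, each neighbourhood of a deleted
    hub that meets [A]: for [B] take three points off [C].  With one hub, [A]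
    and [C] coincide and extend what is left of its neighbourhood.  With two,
    [A] extends the part of the first neighbourhood that avoids the second, and
    [C] adds at most one point.  With three, all eight points remain, so two
    neighbourhoods meet; [C] is their union, and the third one contains at most
    two of its five points. *)
Lemma split_points : S :\: Q != set0 ->
  exists A B : {set G}, [/\ A \subset Q :\: S, B \subset Q :\: S, #|A| = 3 /\ #|B| = 3,
    [disjoint A & B] & forall w, w \in S -> w \notin Q ->
      [disjoint nbhd w & A] \/ [disjoint nbhd w & B]].
Proof.
set P := (Q :\: S)%SET; set T := (S :\: Q)%SET => T0.
have cardP : 5 + #|T| <= #|P|.
  have := cardsID S Q; have := cardsID Q S; rewrite (full_card fQ) -/P -/T.
  by rewrite (setIC Q S); move: S3; lia.
suff [A [C [AP A3 AC C3 hC]]] : exists A C : {set G}, [/\ A \subset P, #|A| = 3,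
    A \subset C, #|C| <= 2 + #|T| & forall w, w \in T ->
    [disjoint nbhd w & A] \/ nbhd w :&: P \subset C].
  have [B BP cardB] := subset_card_exists (P :\: C)%SET 3.
  have BP' : B \subset P by apply: subset_trans BP (subsetDl _ _).
  have BC : [disjoint B & C].
    by rewrite disjoints_subset (subset_trans BP) // setDE subsetIr.
  exists A, B; split=> //.
  - split=> //; rewrite cardB; apply/minn_idPl.
    have : #|P :&: C| <= #|C| by rewrite subset_leq_card ?subsetIr.
    have := cardsID C P; lia.
  - by rewrite disjoint_sym (disjointWr AC).
  - move=> w wS wQ; have [|?|wC] := hC w; first by rewrite inE wQ.
      by left.
    right; rewrite disjoint_sym; apply/pred0P => x /=; apply/negP => /andP[xB xw].
    have xC : x \in C by apply: (subsetP wC); rewrite inE xw (subsetP BP').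
    by move/pred0P: BC => /(_ x) /=; rewrite xB xC.
have memT w : w \in T -> w \notin Q /\ #|nbhd w| = 3.
  by rewrite inE => /andP[wQ _]; split=> //; exact: full_deg fQ _ wQ.
have : #|T| <= 3 by apply: leq_trans S3; rewrite subset_leq_card ?subsetDl.
have : forall w, (w \in T) = (w \in enum T) by move=> w; rewrite mem_enum.
have : uniq (enum T) := enum_uniq _.
move: cardP; rewrite (cardE T).
case: (enum T) => [|w1 [|w2 [|w3 [|w4 r]]]] //= cardP uT memE _.
- by case/eqP: T0; apply/setP => w; rewrite memE inE.
- have w1T : w1 \in T by rewrite memE inE.
  have [w1Q w13] := memT _ w1T.
  have [|A [wA AP A3]] := @set_between _ (nbhd w1 :&: P) P 3 (subsetIr _ _).
    rewrite -{1}w13 subset_leq_card ?subsetIl //=; exact: leq_trans cardP.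
  exists A, A; split=> //; first by rewrite A3.
  by move=> w; rewrite memE inE => /eqP->; right.
- have w1T : w1 \in T by rewrite memE !inE eqxx.
  have w2T : w2 \in T by rewrite memE !inE eqxx orbT.
  have [[w1Q w13] [w2Q w23]] := (memT _ w1T, memT _ w2T).
  have meet1 : #|nbhd w1 :&: nbhd w2| <= 1.
    by apply: blocks_meet => //; move: uT; rewrite inE andbT.
  pose D := nbhd w1 :&: P :\: nbhd w2.
  have DU : D \subset P :\: nbhd w2 by rewrite setSD // subsetIr.
  have [|A [DA AU A3]] := @set_between _ D (P :\: nbhd w2) 3 DU.
    apply/andP; split.
      rewrite -w13 subset_leq_card // /D; apply: subset_trans (subsetDl _ _) (subsetIl _ _).
    have : #|P :&: nbhd w2| <= 3 by rewrite -w23 subset_leq_card ?subsetIr.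
    by have := cardsID (nbhd w2) P; move: cardP; lia.
  exists A, (A :|: (nbhd w1 :&: nbhd w2)); split.
  + exact: subset_trans AU (subsetDl _ _).
  + exact: A3.
  + exact: subsetUl.
  + by apply: leq_trans (leq_card_setU _ _) _; rewrite A3 -[2 + 2]/(3 + 1) leq_add2l.
  + move=> w; rewrite memE !inE => /orP[]/eqP->; [right|left].
      apply/subsetP => x; rewrite !inE => /andP[wx xP].
      case: (boolP (adj w2 x)) => w2x; first by rewrite wx orbT.
      by rewrite (subsetP DA) // !inE wx w2x.
    by rewrite disjoint_sym disjoints_subset (subset_trans AU) // setDE subsetIr.
- have PT : P = Q.
    apply/eqP; rewrite eqEcard subsetDl (full_card fQ).
    by apply: leq_trans cardP.
  have TQ w : w \in [:: w1; w2; w3] -> w \notin Q /\ #|nbhd w| = 3.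
    by move=> wT; apply: memT; rewrite memE.
  (* Three disjoint blocks would have nine points. *)
  have [u [v [t [uvt uv]]]] : exists u v t, perm_eq [:: u; v; t] [:: w1; w2; w3] /\
      nbhd u :&: nbhd v != set0.
    have [d12|] := eqVneq (nbhd w1 :&: nbhd w2) set0; last by exists w1, w2, w3.
    have [d13|] := eqVneq (nbhd w1 :&: nbhd w3) set0; last first.
      by exists w1, w3, w2; split=> //; rewrite perm_cons (perm_catC [:: w3] [:: w2]).
    have [d23|] := eqVneq (nbhd w2 :&: nbhd w3) set0; last first.
      by exists w2, w3, w1; split=> //; rewrite (perm_catC [:: w2; w3] [:: w1]).
    have : #|nbhd w1 :|: nbhd w2 :|: nbhd w3| <= 8.
      rewrite -(full_card fQ) subset_leq_card // !subUset !block_points //;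
      by apply: (proj1 (TQ _ _)); rewrite !inE eqxx ?orbT.
    rewrite !cardsU setIUl d12 d13 d23 setU0 cards0 !subn0.
    by rewrite !(proj2 (TQ _ _)) // !inE eqxx ?orbT.
  have mem w : (w \in T) = (w \in [:: u; v; t]) by rewrite memE (perm_mem uvt).
  have uuvt : uniq [:: u; v; t] by rewrite (perm_uniq uvt).
  have [uQ u3] : u \notin Q /\ #|nbhd u| = 3 by apply: memT; rewrite mem !inE eqxx.
  have [vQ v3] : v \notin Q /\ #|nbhd v| = 3 by apply: memT; rewrite mem !inE eqxx orbT.
  have [tQ t3] : t \notin Q /\ #|nbhd t| = 3 by apply: memT; rewrite mem !inE eqxx !orbT.
  move: uuvt; rewrite /= !inE negb_or andbT => /andP[/andP[nuv nut] nvt].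
  have muv := blocks_meet uQ vQ nuv.
  have mut := blocks_meet uQ tQ nut; have mvt := blocks_meet vQ tQ nvt.
  have uv1 : #|nbhd u :&: nbhd v| = 1.
    by apply/eqP; rewrite eqn_leq muv card_gt0.
  pose C := nbhd u :|: nbhd v.
  have C5 : #|C| = 5 by rewrite cardsU u3 v3 uv1.
  have Ct : #|C :&: nbhd t| <= 2.
    rewrite setIUl; apply: leq_trans (leq_card_setU _ _) _.
    exact: leq_add mut mvt.
  have [A AC A3] := subset_card_exists (C :\: nbhd t) 3.
  have A3' : #|A| = 3.
    by rewrite A3; apply/minn_idPl; rewrite cardsD C5; case: #|_| Ct => [|[|[]]].
  exists A, C; split=> //.
  + rewrite PT; apply: subset_trans AC (subset_trans (subsetDl _ _) _).
    by rewrite subUset !block_points.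
  + exact: subset_trans AC (subsetDl _ _).
  + by rewrite C5.
  + move=> w; rewrite mem !inE => /or3P[]/eqP->.
    * by right; apply: subset_trans (subsetIl _ _) (subsetUl _ _).
    * by right; apply: subset_trans (subsetIl _ _) (subsetUr _ _).
    * left; rewrite disjoint_sym disjoints_subset (subset_trans AC) //.
      by rewrite setDE subsetIr.
Qed.
End Split.

Import Order.TTheory GRing.Theory Num.Theory.
Local Open Scope ring_scope.

(** * Crossing parity of polygonal drawings *)

Lemma addb_xorb a b : a (+) b = xorb a b.
Proof. by case: a; case: b. Qed.

(** Proves identities of sums modulo 2. *)
Ltac xor_tauto := rewrite ?addb_xorb; btauto.

Definition det (R : realFieldType) (p q r : R * R) : R :=
  (q.1 - p.1) * (r.2 - p.2) - (q.2 - p.2) * (r.1 - p.1).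

Section Crossings.
Variables (R : realFieldType) (I : eqType) (P : I -> R * R).
Hypothesis general_position : forall i j k, uniq [:: i; j; k] ->
  det (P i) (P j) (P k) != 0.
Implicit Types i j k l m : I.

Definition left_turn i j k := 0 < det (P i) (P j) (P k).

Definition crosses i j k l :=
  (left_turn i j k (+) left_turn i j l) && (left_turn k l i (+) left_turn k l j).

(** For points in general position, [l] lies inside the triangle [ijk]. *)
Definition inside i j k l :=
  (left_turn i j l == left_turn j k l) && (left_turn j k l == left_turn k i l).

Lemma left_turnE i j k : uniq [:: i; j; k] ->
  (left_turn j k i = left_turn i j k) * (left_turn k i j = left_turn i j k) *
  (left_turn j i k = ~~ left_turn i j k) *
  (left_turn i k j = ~~ left_turn i j k) *
  (left_turn k j i = ~~ left_turn i j k).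
Proof.
move=> /general_position nz.
have rot (p q r : R * R) : det q r p = det p q r :> R by rewrite /det; ring.
have opp (p q r : R * R) : (0 < det p q r) = (det q p r < 0).
  rewrite -oppr_gt0; congr (0 < _); rewrite /det; ring.
have neg : (det (P i) (P j) (P k) < 0) = ~~ (0 < det (P i) (P j) (P k)).
  by rewrite -leNgt lt_neqAle nz.
have rot2 (p q r : R * R) : det r p q = det p q r by rewrite -rot.
rewrite /left_turn (rot (P i) (P j)) (rot2 (P i) (P j)).
rewrite (opp (P j) (P i)) (opp (P i) (P k)) (opp (P k) (P j)).
by rewrite (rot (P i) (P j)) (rot2 (P i) (P j)) neg; do !split.
Qed.

Lemma crossesC i j k l : crosses i j k l = crosses k l i j.
Proof. by rewrite /crosses andbC. Qed.

Lemma crosses_refl i k l : crosses i i k l = false.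
Proof.
have d0 q : det (P i) (P i) q = 0 by rewrite /det; ring.
by rewrite /crosses /left_turn !d0 ltxx.
Qed.

(** The alternating sum of the four determinants vanishes, so its terms do not
    all have the same sign. *)
Lemma left_turn4 i j k l : uniq [:: i; j; k; l] ->
  ~~ [&& left_turn j k l != left_turn i k l,
         left_turn i k l != left_turn i j l &
         left_turn i j l != left_turn i j k].
Proof.
rewrite /= !inE !negb_or -!andbA andbT => /and5P[ij ik il jk /andP[jl kl]].
have := @general_position j k l; have := @general_position i k l.
have := @general_position i j l; have := @general_position i j k.
rewrite /= !inE !negb_or ij ik il jk jl kl.
move=> /(_ isT) n1 /(_ isT) n2 /(_ isT) n3 /(_ isT) n4.
have E : det (P j) (P k) (P l) - det (P i) (P k) (P l) + det (P i) (P j) (P l)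
   - det (P i) (P j) (P k) = 0 by rewrite /det; ring.
rewrite /left_turn; move: E n1 n2 n3 n4.
move: (det (P j) (P k) (P l)) (det (P i) (P k) (P l)).
move: (det (P i) (P j) (P l)) (det (P i) (P j) (P k)) => x1 x2 x3 x4 E n1 n2 n3 n4.
by case: (ltgtP x1) n1 => // h1 _; case: (ltgtP x2) n2 => // h2 _;
  case: (ltgtP x3) n3 => // h3 _; case: (ltgtP x4) n4 => // h4 _ //=; exfalso; lra.
Qed.

(** The three-term Pluecker relation between the determinants with first
    argument [i] excludes that its three terms have the same sign. *)
Lemma left_turn5 i j k l m : uniq [:: i; j; k; l; m] ->
  ~~ [&& (left_turn i j k == left_turn i l m) ==
           (left_turn i j l != left_turn i k m) &
         (left_turn i j l != left_turn i k m) ==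
           (left_turn i j m == left_turn i k l)].
Proof.
rewrite /= !inE !negb_or -!andbA andbT.
move=> /and5P[ij ik il im /and5P[jk jl jm kl /andP[km lm]]].
have := @general_position i j k; have := @general_position i l m.
have := @general_position i j l; have := @general_position i k m.
have := @general_position i j m; have := @general_position i k l.
rewrite /= !inE !negb_or ij ik il im jk jl jm kl km lm.
move=> /(_ isT) n6 /(_ isT) n5 /(_ isT) n4 /(_ isT) n3 /(_ isT) n2 /(_ isT) n1.
have E : det (P i) (P j) (P k) * det (P i) (P l) (P m)
  - det (P i) (P j) (P l) * det (P i) (P k) (P m)
  + det (P i) (P j) (P m) * det (P i) (P k) (P l) = 0 by rewrite /det; ring.
rewrite /left_turn; move: E n1 n2 n3 n4 n5 n6.
move: (det (P i) (P j) (P k)) (det (P i) (P l) (P m)) => x1 x2.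
move: (det (P i) (P j) (P l)) (det (P i) (P k) (P m)) => x3 x4.
move: (det (P i) (P j) (P m)) (det (P i) (P k) (P l)) => x5 x6.
move=> E n1 n2 n3 n4 n5 n6.
have sg (x y : R) : x != 0 -> y != 0 ->
    if (0 < x) == (0 < y) then 0 < x * y else x * y < 0.
  move=> nx ny; case: (ltgtP x 0) nx => // hx _; case: (ltgtP y 0) ny => // hy _ /=.
  - by rewrite nmulr_rgt0.
  - by rewrite nmulr_rlt0.
  - by rewrite pmulr_rlt0.
  - by rewrite mulr_gt0.
have := sg _ _ n1 n2; have := sg _ _ n3 n4; have := sg _ _ n5 n6.
move: (x1 * x2) (x3 * x4) (x5 * x6) E => y1 y2 y3 E.
move: ((0 < x1) == _) ((0 < x3) == _) ((0 < x5) == _) => b1 b2 b3.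
by case: b1 b2 b3 => [] [] [] //= h1 h2 h3; exfalso; lra.
Qed.

(** The ten signs determined by five points satisfy five instances of each of
    the two relations above.  Writing all signs in terms of these ten, a
    statement about crossings becomes a statement about ten booleans. *)
Ltac five_points u :=
  let n1 := fresh in let n2 := fresh in let n3 := fresh in
  let n4 := fresh in let n5 := fresh in
  let m1 := fresh in let m2 := fresh in let m3 := fresh in
  let m4 := fresh in let m5 := fresh in
  have n1 := left_turn4 (mask_uniq u [:: true; true; true; true]);
  have n2 := left_turn4 (mask_uniq u [:: true; true; true; false; true]);
  have n3 := left_turn4 (mask_uniq u [:: true; true; false; true; true]);
  have n4 := left_turn4 (mask_uniq u [:: true; false; true; true; true]);
  have n5 := left_turn4 (mask_uniq u [:: false; true; true; true; true]);
  have m1 := left_turn5 u;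
  have m2 := left_turn5 (etrans (rot_uniq 1 _) u);
  have m3 := left_turn5 (etrans (rot_uniq 2 _) u);
  have m4 := left_turn5 (etrans (rot_uniq 3 _) u);
  have m5 := left_turn5 (etrans (rot_uniq 4 _) u);
  move: n1 n2 n3 n4 n5 m1 m2 m3 m4 m5; rewrite /crosses /inside;
  rewrite ?(left_turnE (mask_uniq u [:: true; true; true]));
  rewrite ?(left_turnE (mask_uniq u [:: true; true; false; true]));
  rewrite ?(left_turnE (mask_uniq u [:: true; true; false; false; true]));
  rewrite ?(left_turnE (mask_uniq u [:: true; false; true; true]));
  rewrite ?(left_turnE (mask_uniq u [:: true; false; true; false; true]));
  rewrite ?(left_turnE (mask_uniq u [:: true; false; false; true; true]));
  rewrite ?(left_turnE (mask_uniq u [:: false; true; true; true]));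
  rewrite ?(left_turnE (mask_uniq u [:: false; true; true; false; true]));
  rewrite ?(left_turnE (mask_uniq u [:: false; true; false; true; true]));
  rewrite ?(left_turnE (mask_uniq u [:: false; false; true; true; true]));
  repeat match goal with |- context [left_turn ?x ?y ?z] =>
    let b := fresh in move: (left_turn x y z) => b; move: b end;
  by do 10! case.

(** A segment crosses the boundary of a triangle an odd number of times exactly
    when one of its ends is inside. *)
Lemma crosses_triangle a b c d e : uniq [:: a; b; c; d; e] ->
  crosses a b d e (+) crosses b c d e (+) crosses a c d e =
  inside a b c d (+) inside a b c e.
Proof.
move=> u.
five_points u.
Qed.

Lemma crosses_K5 a b c d e : uniq [:: a; b; c; d; e] ->
  (crosses a b c d (+) crosses a b c e (+) crosses a b d e) (+)
  (crosses a c b d (+) crosses a c b e (+) crosses a c d e) (+)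
  (crosses a d b c (+) crosses a d b e (+) crosses a d c e) (+)
  (crosses a e b c (+) crosses a e b d (+) crosses a e c d) (+)
  (crosses b c d e (+) crosses b d c e (+) crosses b e c d).
Proof.
move=> u.
five_points u.
Qed.

(** Apply [crosses_K5] to the [a]s and two of the [b]s, in the three possible
    ways, and add.  A crossing of an edge between two [a]s with an edge between
    an [a] and a [b] occurs twice.  The crossings of an edge between two [a]s
    with an edge between two [b]s are those of two triangles, and their number
    is even by [crosses_triangle]. *)
Lemma crosses_K33 a1 a2 a3 b1 b2 b3 : uniq [:: a1; a2; a3; b1; b2; b3] ->
  (crosses a1 b1 a2 b2 (+) crosses a1 b1 a2 b3 (+)
   crosses a1 b2 a2 b1 (+) crosses a1 b2 a2 b3 (+)
   crosses a1 b3 a2 b1 (+) crosses a1 b3 a2 b2) (+)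
  (crosses a1 b1 a3 b2 (+) crosses a1 b1 a3 b3 (+)
   crosses a1 b2 a3 b1 (+) crosses a1 b2 a3 b3 (+)
   crosses a1 b3 a3 b1 (+) crosses a1 b3 a3 b2) (+)
  (crosses a2 b1 a3 b2 (+) crosses a2 b1 a3 b3 (+)
   crosses a2 b2 a3 b1 (+) crosses a2 b2 a3 b3 (+)
   crosses a2 b3 a3 b1 (+) crosses a2 b3 a3 b2).
Proof.
move=> u.
have u12 := mask_uniq u [:: true; true; true; true; true; false].
have u13 := mask_uniq u [:: true; true; true; true; false; true].
have u23 := mask_uniq u [:: true; true; true; false; true; true].
have := crosses_K5 u12; have := crosses_K5 u13; have := crosses_K5 u23.
have := crosses_triangle u12; have := crosses_triangle u13.
have := crosses_triangle u23.
set t23 := (X in X = _); set t13 := (X in _ -> X = _ -> _).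
set t12 := (X in _ -> _ -> X = _ -> _) => E23 E13 E12.
set k23 := (X in is_true X -> _); set k13 := (X in _ -> is_true X -> _).
set k12 := (X in _ -> _ -> is_true X -> _) => K23 K13 K12.
have sum : k12 (+) k13 (+) k23 (+) (t12 (+) t13 (+) t23) = true.
  rewrite K12 K13 K23 E12 E13 E23; xor_tauto.
rewrite /is_true -sum.
rewrite /k12 /k13 /k23 /t12 /t13 /t23; xor_tauto.
Qed.

Implicit Types (s t : seq I) (x y : I).

(** A polygonal chain is given by its first vertex and the list of the others,
    as in [path]. *)
Fixpoint hits x s y z : bool :=
  if s is x' :: s' then crosses x x' y z (+) hits x' s' y z else false.

Fixpoint crossing_parity x s y t : bool :=
  if t is y' :: t' then hits x s y y' (+) crossing_parity x s y' t' else false.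

Lemma crossing_parity_nil x y t : crossing_parity x [::] y t = false.
Proof. by elim: t y => //= y' t IH y; rewrite IH. Qed.

Lemma crossing_parity_cons x x' s y t : crossing_parity x (x' :: s) y t =
  crossing_parity x [:: x'] y t (+) crossing_parity x' s y t.
Proof. by elim: t y => //= y' t IH y; rewrite IH; xor_tauto. Qed.

Lemma crossing_parityC x s y t :
  crossing_parity x s y t = crossing_parity y t x s.
Proof.
elim: s x => [|x' s IH] x /=; first exact: crossing_parity_nil.
rewrite crossing_parity_cons IH; congr (_ (+) _).
by elim: t y {IH} => //= y' t IH y; rewrite IH crossesC addbF.
Qed.

Lemma crosses_swap i j k l : k \notin [:: i; j] -> l \notin [:: i; j] ->
  crosses j i k l = crosses i j k l.
Proof.
have [<-//|ij] := eqVneq i j.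
have u m : m \notin [:: i; j] -> uniq [:: i; j; m].
  rewrite !inE negb_or /= !inE !negb_or ij andbT => /andP[mi mj].
  by rewrite ![_ == m]eq_sym mi mj.
move=> /u/left_turnE uk /u/left_turnE ul.
rewrite /crosses !uk !ul addbN addNb negbK; congr (_ && _); exact: addbC.
Qed.

(** The colouring tells the inside of the triangle from the outside; a
    degenerate triangle has no inside. *)
Lemma triangle_colouring x z y : exists phi : I -> bool, forall u t,
  {in u :: t, forall i, i \notin [:: x; z; y]} ->
  crossing_parity x [:: z] u t (+) crossing_parity z [:: y] u t (+)
  crossing_parity x [:: y] u t = phi u (+) phi (last u t).
Proof.
pose phi i := uniq [:: x; z; y] && inside x z y i.
exists phi => u t; elim: t u => [|v t IH] u dis /=; first by rewrite addbb.
have /IH E : {in v :: t, forall i, i \notin [:: x; z; y]}.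
  by move=> i it; apply: dis; rewrite inE it orbT.
have : phi u (+) phi v = crosses x z u v (+) crosses z y u v (+) crosses x y u v.
  have ud : u \notin [:: x; z; y] by apply: dis; rewrite inE eqxx.
  have vd : v \notin [:: x; z; y] by apply: dis; rewrite !inE eqxx orbT.
  have [<-|uv] := eqVneq u v; first by rewrite /crosses !addbb.
  rewrite /phi; have [uxzy|/=] := boolP (uniq _).
    rewrite /= -crosses_triangle //.
    rewrite -[[:: _; _; _; _; _]]/([:: x; z; y] ++ [:: u; v]) cat_uniq uxzy.
    apply/and3P; split=> //; last by rewrite /= inE uv.
    by apply/hasPn => i; rewrite [i \in _]inE mem_seq1 => /orP[] /eqP->.
  rewrite !inE negb_and !negb_or !negbK andbT.
  have [<- _|xz] := eqVneq x z; first by rewrite crosses_refl addFb addbb.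
  have [zx _|xy /=] := eqVneq x y; last first.
    by move/eqP<-; rewrite crosses_refl addbF addbb.
  subst y; rewrite crosses_refl (@crosses_swap x z) ?addbb //.
    by move: ud; rewrite !inE !negb_or => /and3P[-> ->].
  by move: vd; rewrite !inE !negb_or => /and3P[-> ->].
move: (phi u) (phi v) (phi (last v t)) E => p q r E F.
have -> : p (+) r = (p (+) q) (+) (q (+) r) by xor_tauto.
rewrite F -E; xor_tauto.
Qed.

(** A closed polygon colours the vertices off it in two colours, and a chain
    crosses it an odd number of times exactly when its ends have different
    colours.  The polygon is cut into triangles with apex at the end of the
    chain, and their colourings are added. *)
Lemma closed_chain_colouring x s : exists phi : I -> bool, forall u t,
  {in u :: t, forall i, i \notin x :: s} ->
  crossing_parity x s u t (+) crossing_parity x [:: last x s] u t =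
  phi u (+) phi (last u t).
Proof.
elim: s x => [|z s IH] x.
  exists (fun=> false) => u t _ /=; rewrite crossing_parity_nil.
  by elim: t u => //= v t IH u; rewrite crosses_refl IH.
have [phi Hphi] := IH z; have [psi Hpsi] := triangle_colouring x z (last z s).
exists (fun i => phi i (+) psi i) => u t dis /=.
have /Hphi : {in u :: t, forall i, i \notin z :: s}.
  by move=> i /dis; rewrite inE negb_or => /andP[].
have /Hpsi : {in u :: t, forall i, i \notin [:: x; z; last z s]}.
  move=> i /dis ni; apply/negP; rewrite !inE => /or3P[] /eqP ie; move: ni.
  - by rewrite ie inE eqxx.
  - by rewrite ie !inE eqxx orbT.
  - by rewrite ie in_cons mem_last orbT.
move=> E2 E1; rewrite crossing_parity_cons.
transitivity ((phi u (+) phi (last u t)) (+) (psi u (+) psi (last u t))).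
  rewrite -E1 -E2; xor_tauto.
xor_tauto.
Qed.

End Crossings.

Definition disjoint_edges (e f : nat * nat) :=
  [&& e.1 != f.1, e.1 != f.2, e.2 != f.1 & e.2 != f.2].

Lemma disjoint_edgesC e f : disjoint_edges e f = disjoint_edges f e.
Proof.
rewrite /disjoint_edges (eq_sym f.1) (eq_sym f.1) (eq_sym f.2) (eq_sym f.2).
by case: (e.1 == f.1) (e.1 == f.2) (e.2 == f.1) => [] [] [].
Qed.

(** A graph with vertices 0, 1, 2, ... is given by the list of its edges. *)
Section Drawing.
Variables (R : realFieldType) (I : eqType) (P : I -> R * R).
Hypothesis general_position : forall i j k, uniq [:: i; j; k] ->
  det (P i) (P j) (P k) != 0.
Variable es : seq (nat * nat).
Variables (v : nat -> I) (chain : nat * nat -> seq I).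

(** Disjoint edges have different first ends, which are used to count each pair
    once. *)
Definition total_crossing (c : nat * nat -> seq I) :=
  \big[addb/false]_(e <- es) \big[addb/false]_(f <- es |
     disjoint_edges e f && (e.1 < f.1)%N)
    crossing_parity P (v e.1) (c e) (v f.1) (c f).

(* The edges disjoint from [e] form a graph with even degrees, which is tested
   on the colourings of its vertices. *)
Hypothesis even_complement : forall (e : nat * nat) (phi : nat -> bool), e \in es ->
  \big[addb/false]_(f <- es | disjoint_edges e f) (phi f.1 (+) phi f.2) = false.
Hypothesis last_chain : forall e : nat * nat, e \in es -> last (v e.1) (chain e) = v e.2.
Hypothesis disjoint_chains : forall e f : nat * nat, e \in es -> f \in es ->
  disjoint_edges e f ->
  {in v f.1 :: chain f, forall i, i \notin v e.1 :: chain e}.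

(** The chains are straightened one at a time, in the order of their first
    ends.  When it is the turn of [e], the edges disjoint from [e] are in part
    straight and in part not; by evenness they cross the closed polygon formed
    by the chain of [e] and its segment an even number of times. *)
Lemma total_crossing_straight :
  total_crossing chain = total_crossing (fun e => [:: v e.2]).
Proof.
suff : total_crossing chain (+) total_crossing (fun e => [:: v e.2]) = false.
  by case: (total_crossing _) (total_crossing _) => [] [].
rewrite /total_crossing -big_split /=.
pose s (e : nat * nat) := [:: v e.2].
pose C (e : nat * nat) c (f : nat * nat) d :=
  crossing_parity P (v e.1) (c e : seq I) (v f.1) (d f : seq I).
pose z (e f : nat * nat) d := C e chain f d (+) C e s f d.
have split_sum e : \big[addb/false]_(f <- es | disjoint_edges e f && (e.1 < f.1)%N)
    C e chain f chain (+)
  \big[addb/false]_(f <- es | disjoint_edges e f && (e.1 < f.1)%N) C e s f s =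
  \big[addb/false]_(f <- es | disjoint_edges e f && (e.1 < f.1)%N) z e f chain (+)
  \big[addb/false]_(f <- es | disjoint_edges e f && (e.1 < f.1)%N) z f e s.
  rewrite -!big_split; apply: eq_bigr => f _ /=; rewrite /z /C.
  rewrite (crossing_parityC P (v f.1) (chain f)) (crossing_parityC P (v f.1) (s f)).
  xor_tauto.
rewrite (eq_bigr _ (fun e _ => split_sum e)) big_split /=.
rewrite [X in _ (+) X](exchange_big_dep xpredT) //= -big_split.
rewrite big_seq big1 // => e ees /=.
(* The drawing at the time when [e] is straightened. *)
pose h (f : nat * nat) := if (e.1 < f.1)%N then chain f else s f.
transitivity (\big[addb/false]_(f <- es | disjoint_edges e f) z e f h).
  rewrite [RHS](bigID (fun f : nat * nat => (e.1 < f.1)%N)) /=; congr (_ (+) _).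
    by apply: eq_bigr => f /andP[_ ef]; rewrite /z /C /h ef.
  apply: eq_big => [f|f /andP[_ ef]].
    rewrite (disjoint_edgesC f) /disjoint_edges.
    by case: (ltngtP e.1 f.1) => _; rewrite ?andbF ?andbT.
  by rewrite /z /C /h ltnNge ltnW.
have [phi phiE] := closed_chain_colouring general_position (v e.1) (chain e).
rewrite -[RHS](@even_complement e (phi \o v)) // big_seq_cond [RHS]big_seq_cond.
apply: eq_bigr => f /andP[fes ef]; rewrite /z /C /s -(last_chain ees) phiE.
  by rewrite /h; case: ifP => _ /=; rewrite ?last_chain.
have := disjoint_chains ees fes ef; rewrite /h; case: ifP => // _ dis i.
rewrite !inE => /orP[]/eqP->; first by apply: dis; rewrite inE eqxx.
by apply: dis; rewrite -(last_chain fes) mem_last.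
Qed.

End Drawing.

Definition K5_edges : seq (nat * nat) :=
  [:: (0, 1); (0, 2); (0, 3); (0, 4); (1, 2); (1, 3); (1, 4); (2, 3); (2, 4);
      (3, 4)]%N.

Definition K33_edges : seq (nat * nat) :=
  [:: (0, 3); (0, 4); (0, 5); (1, 3); (1, 4); (1, 5); (2, 3); (2, 4);
      (2, 5)]%N.

Lemma K5_even_complement e (phi : nat -> bool) : e \in K5_edges ->
  \big[addb/false]_(f <- K5_edges | disjoint_edges e f)
    (phi f.1 (+) phi f.2) = false.
Proof.
rewrite !inE; do ![case/orP]; move/eqP->; rewrite unlock /=; xor_tauto.
Qed.

Lemma K33_even_complement e (phi : nat -> bool) : e \in K33_edges ->
  \big[addb/false]_(f <- K33_edges | disjoint_edges e f)
    (phi f.1 (+) phi f.2) = false.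
Proof.
rewrite !inE; do ![case/orP]; move/eqP->; rewrite unlock /=; xor_tauto.
Qed.

Section Parity.
Variables (R : realFieldType) (I : eqType) (P : I -> R * R).
Hypothesis general_position : forall i j k, uniq [:: i; j; k] ->
  det (P i) (P j) (P k) != 0.
Variable v : nat -> I.

Lemma total_crossing_K5 : uniq [seq v i | i <- iota 0 5] ->
  total_crossing P K5_edges v (fun e => [:: v e.2]).
Proof.
move/(crosses_K5 general_position) => odd; rewrite /is_true -odd.
rewrite /total_crossing unlock /=; xor_tauto.
Qed.

Lemma total_crossing_K33 : uniq [seq v i | i <- iota 0 6] ->
  total_crossing P K33_edges v (fun e => [:: v e.2]).
Proof.
move/(crosses_K33 general_position) => odd; rewrite /is_true -odd.
rewrite /total_crossing unlock /=; xor_tauto.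
Qed.

End Parity.

From mathcomp Require Import all_classical all_reals all_analysis.
Import Order.TTheory GRing.Theory Num.Theory.
Import numFieldNormedType.Exports.
Local Open Scope classical_set_scope.

(** * From arcs to polygonal chains *)

Section Linked.
Variable R : realType.
Implicit Types (A B : set (R * R)) (p q r : R * R).

(** Joined inside [A] by chains of arbitrarily small steps.  Unlike arcs, linked
    pairs can be composed without reparametrization. *)
Definition linked A p q := forall e : R, 0 < e ->
  exists (n : nat) (f : nat -> R * R),
    [/\ f 0%N = p, f n = q, forall i, (i <= n)%N -> A (f i) &
        forall i, (i < n)%N -> ball (f i) e (f i.+1)].

Lemma linked_sub A B p q : A `<=` B -> linked A p q -> linked B p q.
Proof.
move=> AB lA e /lA[n [f [f0 fn fA fe]]]; exists n, f; split=> // i /fA; exact: AB.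
Qed.

Lemma linked_trans A p q r : linked A p q -> linked A q r -> linked A p r.
Proof.
move=> lA lA' e e0; have [n [f [f0 fn fA fe]]] := lA e e0.
have [m [g [g0 gm gA ge]]] := lA' e e0.
exists (n + m)%N, (fun i => if (i <= n)%N then f i else g (i - n)%N).
split=> //.
- case: leqP => [|_]; last by rewrite addKn.
  by rewrite -[X in (_ <= X)%N]addn0 leq_add2l leqn0 => /eqP m0;
    rewrite m0 addn0 fn -g0 -gm m0.
- by move=> i; case: (leqP i n) => [/fA//|_]; rewrite -leq_subLR => /gA.
- move=> i; case: (ltngtP i n) => [/fe//|ni|->].
    by rewrite -ltn_subLR ?(ltnW ni) // subSn ?(ltnW ni) // => /ge.
  by rewrite fn -g0 subSnn -[X in (X < _)%N]addn0 ltn_add2l => /ge.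
Qed.

(** Uniform continuity of [g]. *)
Lemma linked_path (g : R -> R * R) : {within `[0, 1], continuous g} ->
  linked (g @` `[0, 1]) (g 0) (g 1).
Proof.
move=> /subspace_continuousP gc e e0.
pose P (n : nat) x := forall y, `[0, 1]%classic y ->
  `|x - y| <= n.+1%:R^-1 -> ball (g x) e (g y).
have cpt : near_covering_within (`[0, 1] : set R).
  by apply/near_covering_withinP/compact_near_coveringP/segment_compact.
have : \forall n \near \oo, (`[0, 1] : set R) `<=` P n.
  apply: cpt => x xI; have e2 : 0 < e / 2 by rewrite divr_gt0.
  have /nbhs_ballP[r /= r0 rI] := gc _ xI _ (nbhsx_ballx (g x) (e / 2) e2).
  have r20 : 0 < r / 2 by rewrite divr_gt0.
  near=> x' n => x'I y yI xy.
  have xx' : ball x (r / 2) x' by near: x'; exact: nbhsx_ballx.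
  have r2 : n.+1%:R^-1 < r / 2.
    by near: n; exact: (near_infty_natSinv_lt (PosNum r20)).
  apply: (@ball_splitr _ _ (g x)); apply: rI => //=.
    by apply: le_ball xx'; lra.
  apply: (@ball_split _ _ x') => //=.
  exact: le_lt_trans r2.
case=> n _ /(_ _ (leqnn n)) gn.
have div01 i : (i <= n.+1)%N -> `[0, 1]%classic (i%:R / n.+1%:R : R).
  move=> ile; rewrite /= in_itv /= divr_ge0 //= ler_pdivrMr ?ltr0n // mul1r.
  by rewrite ler_nat.
exists n.+1, (fun i => g (i%:R / n.+1%:R)); split.
- by rewrite mul0r.
- by rewrite divff // pnatr_eq0.
- by move=> i /div01 iI; exists (i%:R / n.+1%:R).
- move=> i lin; apply: gn; [exact/div01/ltnW|exact: div01|].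
  rewrite -mulrBl -natr1 opprD addrA subrr sub0r normrM normrN1 mul1r.
  by rewrite ger0_norm // invr_ge0.
Unshelve. all: by end_near. Qed.

Lemma arc_linked A p q : arc_between A p q -> compact A /\ linked A p q.
Proof.
case=> g [gc _ <- <- ->]; split; last exact: linked_path.
exact: continuous_compact (@segment_compact R 0 1).
Qed.

Lemma compact_separated A B : compact A -> compact B -> A `&` B = set0 ->
  \forall d \near 0^'+, forall p q : R * R, A p -> B q -> ~ ball p d q.
Proof.
move=> cA cB AB0.
pose P (d : R) p := forall q, B q -> ~ ball p d q.
have : \forall d \near 0^'+, A `<=` P d.
  apply: (iffLR (compact_near_coveringP A)) => // p Ap.
  have : nbhs p (~` B).
    apply: open_nbhs_nbhs; split; last by move=> Bp; have: set0 p by rewrite -AB0.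
    by apply: closed_openC; apply: compact_closed => //; exact: norm_hausdorff.
  move=> /nbhs_ballP[r /= r0 rB]; have r20 : 0 < r / 2 by rewrite divr_gt0.
  near=> p' d.
  have dr : d <= r / 2 by near: d; exact: nbhs_right_le.
  have pp' : ball p (r / 2) p' by near: p'; exact: nbhsx_ballx.
  move=> q Bq p'q.
  suff : (~` B) q by [].
  apply: rB; apply: (@ball_split _ _ p') => //; exact: le_ball p'q.
by apply: filterS => d AP p q /AP; apply.
Unshelve. all: by end_near. Qed.

End Linked.

Section Polygons.
Variable R : realType.
Implicit Types p q r s : R * R.

Lemma ball_pairE p e q :
  ball p e q = (`|p.1 - q.1| < e /\ `|p.2 - q.2| < e) :> Prop.
Proof. by []. Qed.

Lemma small_nonroot (h : {poly R}) (e : R) : h != 0 -> 0 < e ->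
  exists2 t, 0 < t < e & ~~ root h t.
Proof.
move=> h0 e0.
pose ts := [seq e / k.+2%:R | k <- iota 0 (size h)].
have : ~~ all (root h) ts.
  apply/negP => /(max_poly_roots h0); rewrite size_map size_iota ltnn => H.
  have // : false; apply: H; rewrite map_inj_uniq ?iota_uniq // => i j.
  move=> /(mulfI (lt0r_neq0 e0))/invr_inj/eqP.
  by rewrite eqr_nat => /eqP[].
move=> /allPn[_ /mapP[k _ ->] nr]; exists (e / k.+2%:R) => //.
rewrite divr_gt0 ?ltr0n //= ltr_pdivrMr ?ltr0n //.
by rewrite ltr_pMr // ltr1n.
Qed.

(** Move the i-th point by t (i, i^2).  The determinant of three moved points is
    a polynomial in t, whose coefficient at t^2 is a Vandermonde determinant;
    so only finitely many t fail. *)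
Lemma perturb_general_position (I : finType) (P : I -> R * R) (e : R) : 0 < e ->
  exists2 Q : I -> R * R, forall i, ball (P i) e (Q i) &
    forall i j k, uniq [:: i; j; k] -> det (Q i) (Q j) (Q k) != 0.
Proof.
move=> e0.
pose a (i : I) : R := (enum_rank i)%:R.
pose x i := (P i).1%:P + (a i)%:P * 'X.
pose y i := (P i).2%:P + (a i ^+ 2)%:P * 'X.
pose D i j k : {poly R} :=
  (x j - x i) * (y k - y i) - (y j - y i) * (x k - x i).
pose D2 i j k := (a j - a i) * (a k - a i) * (a k - a j).
have Dn0 i j k : uniq [:: i; j; k] -> D i j k != 0.
  rewrite /= !inE !negb_or andbT -andbA => /and3P[ij ik jk].
  have inj u v : u != v -> a v - a u != 0.
    move=> uv; rewrite subr_eq0 eqr_nat; apply: contra uv => /eqP uv.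
    by apply/eqP/enum_rank_inj/val_inj.
  have Dnz : D2 i j k != 0 by rewrite !mulf_neq0 ?inj.
  apply: contra_neq Dnz => Dz.
  (* The second difference of a quadratic is twice its leading coefficient. *)
  have : (D i j k).[1] + (D i j k).[-1] - 2 * (D i j k).[0] = 2 * D2 i j k.
    by rewrite /D /x /y /D2 !hornerE /=; ring.
  rewrite Dz !horner0 mulr0 subr0 addr0 => /eqP.
  by rewrite eq_sym mulf_eq0 pnatr_eq0 /= => /eqP.
pose h := \prod_(ijk : I * I * I | uniq [:: ijk.1.1; ijk.1.2; ijk.2])
  D ijk.1.1 ijk.1.2 ijk.2.
have h0 : h != 0 by apply/prodf_neq0 => -[[i j] k] /Dn0.
pose M : R := 1 + #|I|%:R ^+ 2.
have M1 : 1 <= M by rewrite lerDl exprn_ge0.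
have M0 : 0 < M by apply: lt_le_trans M1.
have [t /andP[t0 te] tr] := small_nonroot h0 (divr_gt0 e0 M0).
have tM : t * M < e by rewrite -ltr_pdivlMr.
have small (c : R) : 0 <= c -> c < M -> `|c * t| < e.
  move=> c0 cM; rewrite ger0_norm; last by rewrite mulr_ge0 // ltW.
  by apply: lt_trans tM; rewrite mulrC ltr_pM2l.
exists (fun i => ((P i).1 + a i * t, (P i).2 + a i ^+ 2 * t)).
  have a0 i : 0 <= a i by [].
  have aI i : a i ^+ 2 < M.
    by rewrite ltr_pwDl // lerXn2r ?nnegrE // ler_nat ltnW.
  move=> i; rewrite ball_pairE /= !opprD !addrA !subrr !sub0r !normrN.
  split; apply: small => //; last exact: exprn_ge0.
  apply: le_lt_trans (aI i); rewrite /a; case: (nat_of_ord _) => [|n].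
    by rewrite expr0n.
  by rewrite expr2 ler_peMr // ler1n.
move=> i j k u; apply: contra tr => /eqP d0.
rewrite /root /h (bigD1 (i, j, k)) //= hornerM.
suff -> : (D i j k).[t] = 0 by rewrite mul0r.
by rewrite -d0 /D /x /y /det !hornerE /=; ring.
Qed.

Lemma crossing_point p q r s :
  (0 < det p q r) (+) (0 < det p q s) -> (0 < det r s p) (+) (0 < det r s q) ->
  det p q r != 0 -> det p q s != 0 -> det r s p != 0 -> det r s q != 0 ->
  exists z u v, [/\ 0 <= u <= 1, 0 <= v <= 1,
    z = (p.1 + u * (q.1 - p.1), p.2 + u * (q.2 - p.2)) &
    z = (r.1 + v * (s.1 - r.1), r.2 + v * (s.2 - r.2))].
Proof.
move=> c1 c2 n1 n2 n3 n4.
have ratio (x y : R) : (0 < x) (+) (0 < y) -> x != 0 -> y != 0 ->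
    x - y != 0 /\ 0 <= x / (x - y) <= 1.
  case: (ltgtP x 0) => // hx; case: (ltgtP y 0) => // hy _ _ _.
    have d : x - y < 0 by lra.
    by rewrite ltr0_neq0 // ler_ndivrMr // mul1r ler_ndivlMr //; split=> //; lra.
  have d : 0 < x - y by lra.
  by rewrite lt0r_neq0 // ler_pdivrMr // mul1r ler_pdivlMr //; split=> //; lra.
have [d1 v01] := ratio _ _ c1 n1 n2; have [d2 u01] := ratio _ _ c2 n3 n4.
set u := (det r s p / _) in u01; set v := (det p q r / _) in v01.
exists (p.1 + u * (q.1 - p.1), p.2 + u * (q.2 - p.2)), u, v; split=> //.
rewrite /u /v; move: d1 d2; rewrite /det => d1 d2.
by congr (_, _); field; rewrite d1 d2.
Qed.

Lemma crossing_ball p q r s e :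
  (0 < det p q r) (+) (0 < det p q s) -> (0 < det r s p) (+) (0 < det r s q) ->
  det p q r != 0 -> det p q s != 0 -> det r s p != 0 -> det r s q != 0 ->
  ball p e q -> ball r e s -> ball p (e + e) r.
Proof.
move=> c1 c2 n1 n2 n3 n4.
have [z [u [v [u01 v01 zp zr]]]] := crossing_point c1 c2 n1 n2 n3 n4.
have near (a b w : R) : 0 <= w <= 1 -> `|a - b| < e -> `|a - (a + w * (b - a))| < e.
  move=> /andP[w0 w1] ab; rewrite opprD addrA subrr sub0r normrN normrM.
  rewrite ger0_norm // distrC; apply: le_lt_trans ab.
  by rewrite ler_piMl.
move=> [pq1 pq2] [rs1 rs2]; apply: (@ball_triangle _ _ z).
  by rewrite zp; split; apply: near.
by apply: ball_sym; rewrite zr; split; apply: near.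
Qed.

End Polygons.

Lemma near_all (T : eqType) (s : seq T) (U : Type) (F : set_system U)
    (Q : T -> set U) : Filter F ->
  (forall x, x \in s -> \near F, Q x F) -> \forall d \near F, forall x, x \in s -> Q x d.
Proof.
move=> FF; elim: s => [|x s IH] H; first by apply: filterE => d y.
have sQ := IH (fun y ys => H y (mem_behead (s := x :: s) ys)).
have xQ := H x (mem_head x s).
by apply: filterS2 xQ sQ => d Qx Qs y; rewrite inE => /orP[/eqP->//|/Qs].
Qed.

Section Loose.
Variable R : realType.

(** Only disjoint edges are kept apart: edges with a common end may meet
    anywhere. *)
Definition loosely_drawn (es : seq (nat * nat)) :=
  exists (pos : nat -> R * R) (L : nat * nat -> set (R * R)),
    (forall e, e \in es -> compact (L e) /\ linked (L e) (pos e.1) (pos e.2)) /\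
    (forall e f, e \in es -> f \in es -> disjoint_edges e f ->
       L e `&` L f = set0).

Lemma crossing_parity_false (I : eqType) (P : I -> R * R) (r1 r2 : rel I) x s y t :
  path r1 x s -> path r2 y t ->
  (forall a b c d, r1 a b -> r2 c d -> crosses P a b c d = false) ->
  crossing_parity P x s y t = false.
Proof.
move=> ps pt no; elim: t y pt => //= y' t IH y /andP[yy' pt]; rewrite (IH _ pt).
elim: s x ps {IH} => //= x' s IH x /andP[xx' /IH].
by rewrite !addbF => ->; rewrite (no _ _ _ _ xx' yy').
Qed.

Lemma path_iota (I : Type) (r : rel I) (g : nat -> I) m n :
  (forall k, (k < m + n)%N -> r (g k) (g k.+1)) ->
  path r (g m) [seq g k | k <- iota m.+1 n].
Proof.
elim: n m => //= n IH m H; rewrite H ?IH //; last by rewrite addnS ltnS leq_addr.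
by move=> k; rewrite addSnnS; exact: H.
Qed.

Lemma last_iota (I : Type) (g : nat -> I) m n :
  last (g m) [seq g k | k <- iota m.+1 n] = g (m + n)%N.
Proof. by elim: n m => [|n IH] m /=; rewrite ?addn0 // IH addSnnS. Qed.

(** Chains with small steps inside the sets [L e] are moved into general
    position.  Segments of disjoint edges are then too far apart to cross, so
    all crossing parities vanish, against the parity of the straight drawing.
    The bound 6 on the vertices covers both graphs. *)
Lemma not_loosely_drawn es :
  (forall e, e \in es -> (e.1 < 6)%N && (e.2 < 6)%N) ->
  (forall e (phi : nat -> bool), e \in es ->
    \big[addb/false]_(f <- es | disjoint_edges e f) (phi f.1 (+) phi f.2) = false) ->
  (forall (I : eqType) (P : I -> R * R) (v : nat -> I),
    (forall i j k, uniq [:: i; j; k] -> det (P i) (P j) (P k) != 0) ->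
    uniq [seq v i | i <- iota 0 6] ->
    total_crossing P es v (fun e => [:: v e.2])) ->
  ~ loosely_drawn es.
Proof.
move=> es6 even odd [pos [L [Ld Ldis]]].
have [d d0 dL] : exists2 d : R, 0 < d & forall e f, e \in es -> f \in es ->
    disjoint_edges e f -> forall p q, L e p -> L f q -> ~ ball p d q.
  have H : \forall d \near (0 : R)^'+, forall ef, ef \in [seq (e, f) | e <- es, f <- es] ->
      disjoint_edges ef.1 ef.2 -> forall p q, L ef.1 p -> L ef.2 q -> ~ ball p d q.
    apply: near_all => -[_ _] /allpairsP[[e f] /= [ees fes [-> ->]]].
    case: (boolP (disjoint_edges e f)) => [dis|_]; last exact: filterE.
    have := compact_separated (proj1 (Ld _ ees)) (proj1 (Ld _ fes)) (Ldis _ _ ees fes dis).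
    by apply: filterS => d H _.
  have [d [d0 Hd]] := filter_ex (filterI (nbhs_right_gt (0 : R)) H).
  by exists d => // e f ees fes dis; apply: (Hd (e, f)) => //; exact: allpairs_f.
(* Two crossing segments with ends moved by [eps] and steps below 3 [eps] have
   unmoved ends within 8 [eps] of each other. *)
pose eps := d / 8; have eps0 : 0 < eps by rewrite divr_gt0.
have /choice[n /choice[f fP]] : forall e, exists (n : nat) (f : nat -> R * R),
    e \in es -> [/\ f 0%N = pos e.1, f n = pos e.2,
     forall i, (i <= n)%N -> L e (f i) &
     forall i, (i < n)%N -> ball (f i) eps (f i.+1)].
  move=> e; case: (boolP (e \in es)) => [ees|_].
    by have [n [f H]] := proj2 (Ld _ ees) _ eps0; exists n, f.
  by exists 0%N, (fun=> 0).
pose N := \max_(e <- es) n e.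
have nN e : e \in es -> (n e <= N)%N by move=> ees; exact: leq_bigmax_seq.
pose I : finType := ('I_6 + 'I_6 * 'I_6 * 'I_N.+1)%type.
pose P (i : I) := match i with
  | inl a => pos a
  | inr (a, b, k) => let e : nat * nat := (val a, val b) in f e (minn k (n e))
  end.
have [Q PQ gp] := perturb_general_position P eps0.
pose v k : I := inl (inord k).
pose w (e : nat * nat) k : I := if k == 0%N then v e.1 else
  if k == N.+1 then v e.2 else inr (inord e.1, inord e.2, inord k).
pose chain e := [seq w e k | k <- iota 1 N.+1].
have inj6 i j : (i < 6)%N -> (j < 6)%N -> inord i = inord j :> 'I_6 -> i = j.
  by move=> i6 j6 /(congr1 val) /=; rewrite !inordK.
have uv : uniq [seq v i | i <- iota 0 6].
  by rewrite map_inj_in_uniq // => i j; rewrite !mem_iota /= => i6 j6 [/inj6]; apply.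
have Pw e k : e \in es -> (k <= N.+1)%N -> P (w e k) = f e (minn k (n e)).
  move=> ees kN; have /andP[e1 e2] := es6 _ ees; have [f0 fn _ _] := fP _ ees.
  rewrite /w; case: eqP => [->|_]; first by rewrite min0n f0 /= inordK.
  case: eqP => [->|/eqP kN1].
    by rewrite (minn_idPr (leqW (nN _ ees))) fn /= inordK.
  rewrite /= !inordK //; first by case: (e).
  by rewrite ltn_neqAle kN1.
have LP e k : e \in es -> L e (f e (minn k (n e))).
  by move=> ees; have [_ _ fL _] := fP _ ees; apply: fL; exact: geq_minr.
pose r e : rel I := fun i j =>
  [&& `[< L e (P i) >], `[< ball (P i) eps (P j) >] &
      (i \in v e.1 :: chain e) && (j \in v e.1 :: chain e)].
have w_mem e k : (k <= N.+1)%N -> w e k \in v e.1 :: chain e.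
  by move=> kN; apply: (@map_f _ _ (w e) (iota 0 N.+2)); rewrite mem_iota.
have chainP e : e \in es -> path (r e) (v e.1) (chain e).
  move=> ees; apply: (@path_iota _ _ (w e) 0) => k kN.
  rewrite /r (Pw _ _ ees (ltnW kN)) (Pw _ _ ees kN).
  rewrite !w_mem ?(ltnW kN) // !andbT.
  apply/andP; split; apply/asboolP; first exact: LP.
  have [_ _ _ fb] := fP _ ees; case: (leqP (n e) k) => nk.
    by rewrite (minn_idPr (leqW nk)); exact: ballxx.
  by rewrite (minn_idPl nk) ; exact: fb.
have chain_last e : e \in es -> last (v e.1) (chain e) = v e.2.
  move=> ees; rewrite -[v e.1]/(w e 0%N) last_iota add0n /w.
  by rewrite eqxx.
have chain_mem e i : i \in v e.1 :: chain e ->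
    [\/ i = v e.1, i = v e.2 | exists k, i = inr (inord e.1, inord e.2, k)].
  rewrite -[_ :: _]/[seq w e k | k <- iota 0 N.+2] => /mapP[k _ ->]; rewrite /w.
  case: ifP => _; first by constructor 1.
  by case: ifP => _; [constructor 2|constructor 3; exists (inord k)].
have chain_dis e f' : e \in es -> f' \in es -> disjoint_edges e f' ->
    {in v f'.1 :: chain f', forall i, i \notin v e.1 :: chain e}.
  move=> /es6/andP[e1 e2] /es6/andP[f1 f2] /and4P[d1 d2 d3 d4] i fi.
  apply/negP => ei; move: d1 d2 d3 d4.
  case: (chain_mem _ _ fi) => [->|->|[k ->]] in ei *;
    case: (chain_mem _ _ ei) => [||[l]] // [];
    by [move/inj6 => ->; rewrite ?eqxx|move=> /inj6 ->; rewrite ?eqxx].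
have : total_crossing Q es v chain.
  by rewrite (total_crossing_straight gp even chain_last chain_dis); exact: odd.
rewrite /total_crossing big_seq big1 // => e ees; rewrite big_seq_cond big1 //.
move=> f' /andP[fes /andP[dis _]].
apply: (crossing_parity_false (chainP _ ees) (chainP _ fes)) => i i' j j'.
move=> /and3P[/asboolP Li /asboolP bi /andP[iC i'C]].
move=> /and3P[/asboolP Lj /asboolP bj /andP[jC j'C]].
have [<-|ii'] := eqVneq i i'; first exact: crosses_refl.
have [<-|jj'] := eqVneq j j'; first by rewrite crossesC crosses_refl.
apply/negbTE/negP => /andP[c1 c2].
have nz a b : a \in v e.1 :: chain e -> b \in v f'.1 :: chain f' ->
    (b != a) * (a != b).
  move=> aC bC; rewrite (eq_sym a); suff -> : b != a by [].
  by apply: contraTneq aC => <-; exact: (chain_dis _ _ ees fes dis).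
have bQ a b : ball (P a) eps (P b) -> ball (Q a) (eps + eps + eps) (Q b).
  move=> ab; apply: ball_triangle (PQ b); apply: ball_triangle ab.
  exact: ball_sym.
have ij : ball (Q i) (eps + eps + eps + (eps + eps + eps)) (Q j).
  by apply: crossing_ball c1 c2 _ _ _ _ (bQ _ _ bi) (bQ _ _ bj); apply: gp;
    rewrite /= !inE ?negb_or ?ii' ?jj' /= ?(nz _ _ iC jC) ?(nz _ _ iC j'C)
      ?(nz _ _ i'C jC) ?(nz _ _ i'C j'C).
apply: (dL _ _ ees fes dis _ _ Li Lj).
apply: le_ball (ball_triangle (PQ i) (ball_triangle ij (ball_sym (PQ j)))).
by rewrite /eps; lra.
Qed.

Lemma K5_not_loosely_drawn : ~ loosely_drawn K5_edges.
Proof.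
apply: not_loosely_drawn => [e||I P v gp uv].
- by rewrite !inE; do ![case/orP]; move/eqP->.
- exact: K5_even_complement.
- apply: total_crossing_K5 => //.
  exact: (mask_uniq uv [:: true; true; true; true; true; false]).
Qed.

Lemma K33_not_loosely_drawn : ~ loosely_drawn K33_edges.
Proof.
apply: not_loosely_drawn => [e||I P v gp uv].
- by rewrite !inE; do ![case/orP]; move/eqP->.
- exact: K33_even_complement.
- exact: total_crossing_K33.
Qed.

End Loose.

(** * A plane drawing of K_5 minus an edge with hubs in its faces *)

Definition mix (R : realType) (t : R) (p q : R * R) : R * R :=
  ((1 - t) * p.1 + t * q.1, (1 - t) * p.2 + t * q.2).

Section Straight.
Variables (R : realType) (G : sgraph) (pos : G -> R * R).
Hypothesis pos_inj : injective pos.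
Hypothesis vertex_off_edge : forall x y z t, adj x y -> 0 < t < 1 ->
  mix t (pos x) (pos y) <> pos z.
Hypothesis edges_apart : forall x y z w t s, adj x y -> adj z w ->
  0 < t < 1 -> 0 < s < 1 -> mix t (pos x) (pos y) = mix s (pos z) (pos w) ->
  [set x; y]%SET = [set z; w]%SET.

Let segment (e : {set G}) : set (R * R) := [set p | exists x y t,
  [/\ e = [set x; y]%SET, 0 <= t <= 1 & p = mix t (pos x) (pos y)]].

Lemma mix0 (p q : R * R) : mix 0 p q = p.
Proof. by case: p => a b; rewrite /mix subr0 !mul1r !mul0r !addr0. Qed.

Lemma mix1 (p q : R * R) : mix 1 p q = q.
Proof. by case: q => a b; rewrite /mix subrr !mul1r !mul0r !add0r. Qed.

Lemma mixC t (p q : R * R) : mix (1 - t) p q = mix t q p.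
Proof. by rewrite /mix; congr (_, _); ring. Qed.

Lemma segment_arc x y : x != y ->
  arc_between (segment [set x; y]%SET) (pos x) (pos y).
Proof.
move=> xy; exists (fun t => mix t (pos x) (pos y)); split; rewrite ?mix0 ?mix1 //.
- have line (a b : R) : continuous (fun t : R => (1 - t) * a + t * b).
    move=> t; apply: cvgD; apply: cvgM; try exact: cvg_cst; try exact: cvg_id.
    by apply: cvgB; [exact: cvg_cst|exact: cvg_id].
  by apply: continuous_subspaceT => t; exact: cvg_pair (line _ _ t) (line _ _ t).
- move=> t s _ _; rewrite /mix => -[E1 E2].
  apply/eqP/negPn/negP; rewrite -subr_eq0 => ts; case/eqP: xy; apply: pos_inj.
  rewrite [pos x]surjective_pairing [pos y]surjective_pairing.
  by congr (_, _); apply/eqP; rewrite -subr_eq0 -(mulrI_eq0 _ (mulfI ts));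
     apply/eqP; move: E1 E2 => E1 E2; lra.
- rewrite predeqE => p; split=> [[x' [y' [t [e t01 ->]]]]|[t t01 <-]]; last first.
    by exists x, y, t; split=> //; move: t01; rewrite /= in_itv.
  have : x' \in [set x; y]%SET by rewrite e !inE eqxx.
  have : y' \in [set x; y]%SET by rewrite e !inE eqxx orbT.
  have : y \in [set x'; y']%SET by rewrite -e !inE eqxx orbT.
  have : x \in [set x'; y']%SET by rewrite -e !inE eqxx.
  rewrite !inE => xx' yx' /orP[]/eqP y'E /orP[]/eqP x'E; subst x' y'.
  + by move: yx'; rewrite orbb eq_sym (negPf xy).
  + exists (1 - t); rewrite ?mixC //= in_itv /= ; lra.
  + by exists t; rewrite //= in_itv.
  + by move: xx'; rewrite orbb (negPf xy).
Qed.

Lemma edgesP (e : {set G}) : e \in edges G ->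
  exists x y, [/\ adj x y, x != y & e = [set x; y]%SET].
Proof.
rewrite inE => /existsP[x /existsP[y /andP[xy /eqP->]]]; exists x, y; split=> //.
by apply: contraTneq xy => ->; rewrite adj_irr.
Qed.

Lemma edge_point e p : e \in edges G -> segment e p ->
  (exists2 x, x \in e & p = pos x) \/
  exists x y t, [/\ adj x y, e = [set x; y]%SET, 0 < t < 1 & p = mix t (pos x) (pos y)].
Proof.
move=> /edgesP[x0 [y0 [xy0 _ e0]]] [x [y [t [exy /andP[t0 t1] ->]]]].
have [->|tn0] := eqVneq t 0; first by left; exists x; rewrite ?mix0 // exy !inE eqxx.
have [->|tn1] := eqVneq t 1; first by left; exists y; rewrite ?mix1 // exy !inE eqxx orbT.
have [xy|xy] := eqVneq x y.
  left; exists x; first by rewrite exy !inE eqxx.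
  by rewrite -xy /mix -!mulrDl subrK !mul1r; case: (pos x).
right; exists x, y, t; split=> //; last by rewrite !lt_neqAle eq_sym tn0 t0 tn1 t1.
have : y0 \in [set x; y]%SET by rewrite -exy e0 !inE eqxx orbT.
have : x0 \in [set x; y]%SET by rewrite -exy e0 !inE eqxx.
have x0y0 : x0 != y0 by apply: contraTneq xy0 => ->; rewrite adj_irr.
rewrite !inE => /orP[]/eqP xE /orP[]/eqP yE; move: x0y0 xy0; rewrite xE yE ?eqxx //.
by rewrite adj_sym.
Qed.

(** In a straight drawing it is enough that vertices and open edges are pairwise
    disjoint. *)
Lemma straight_planar : planar R G.
Proof.
exists pos, segment; split=> //.
- by move=> x y xy; apply: segment_arc; apply: contraTneq xy => ->; rewrite adj_irr.
- move=> e x eE /(edge_point eE)[[y ye /pos_inj->]//|[y [z [t [yz _ t01 E]]]]].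
  by case: (vertex_off_edge yz t01 (esym E)).
- move=> e f eE fE ef p /(edge_point eE) he /(edge_point fE) hf.
  case: he => [[x xe px]|[x [y [t [xy exy t01 pE]]]]].
    case: hf => [[x' x'f px']|[x' [y' [t [xy _ t01 pE]]]]].
      by exists x => //; rewrite inE xe (pos_inj (etrans (esym px) px')).
    by case: (vertex_off_edge xy t01 (etrans (esym pE) px)).
  case: hf => [[x' x'f px']|[x' [y' [s [xy' fxy' s01 pE']]]]].
    by case: (vertex_off_edge xy t01 (etrans (esym pE) px')).
  case/eqP: ef; rewrite exy fxy'.
  exact: edges_apart xy xy' t01 s01 (etrans (esym pE) pE').
Qed.

End Straight.

(** The points 0, 1, 2, 3, 4 are put at (0,3), (0,1), (-1,0), (1,0), (0,2); 0
    and 1 are the nonadjacent ones.  These are the bounded faces; the unbounded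
    one has the corners 0, 2, 3. *)
Definition faces : seq (seq nat) :=
  [:: [:: 1; 2; 3]; [:: 1; 2; 4]; [:: 1; 3; 4]; [:: 0; 2; 4]; [:: 0; 3; 4]]%N.

Section Coordinates.
Variable R : realType.
Implicit Types m : nat -> R.

(** The point with barycentric coordinates [m] with respect to the five
    points. *)
Definition place m : R * R :=
  (m 3%N - m 2%N, 3 * m 0%N + m 1%N + 2 * m 4%N).

Definition carried (F : seq nat) m : Prop :=
  [/\ forall k, 0 <= m k, forall k, k \notin F -> m k = 0 &
      m 0%N + m 1%N + m 2%N + m 3%N + m 4%N = 1].

(** The faces form a simplicial complex: coordinates carried by a face are
    determined by the point of the plane.  All incidences can therefore be
    checked in coordinates. *)
Lemma place_inj F F' m m' : F \in faces -> F' \in faces ->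
  carried F m -> carried F' m' -> place m = place m' ->
  forall k, (k < 5)%N -> m k = m' k.
Proof.
move=> FF FF' [m0 mF m1] [m0' mF' m1'] [E1 E2].
suff: [/\ m 0%N = m' 0%N, m 1%N = m' 1%N, m 2%N = m' 2%N, m 3%N = m' 3%N &
    m 4%N = m' 4%N] by move=> [? ? ? ? ?] [|[|[|[|[|k]]]]].
move: (m0 0%N) (m0 1%N) (m0 2%N) (m0 3%N) (m0 4%N) m1 E1 E2.
move: (m0' 0%N) (m0' 1%N) (m0' 2%N) (m0' 3%N) (m0' 4%N) m1'.
have zero (c : nat -> R) (C : seq nat) : (forall k, k \notin C -> c k = 0) ->
  forall k, if k \in C then True else c k = 0.
  by move=> cC k; case: ifPn => // /cC.
move: (zero _ _ mF 0%N) (zero _ _ mF 1%N) (zero _ _ mF 2%N).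
move: (zero _ _ mF 3%N) (zero _ _ mF 4%N).
move: (zero _ _ mF' 0%N) (zero _ _ mF' 1%N) (zero _ _ mF' 2%N).
move: (zero _ _ mF' 3%N) (zero _ _ mF' 4%N).
move=> {mF mF' zero}.
move: FF FF'; rewrite !inE; do ![case/orP]; move/eqP->; do ![case/orP]; move/eqP-> => /=;
move: (m 0%N) (m 1%N) (m 2%N) (m 3%N) (m 4%N) => a0 a1 a2 a3 a4;
move: (m' 0%N) (m' 1%N) (m' 2%N) (m' 3%N) (m' 4%N) => b0 b1 b2 b3 b4 *; split; lra.
Qed.

End Coordinates.

Lemma faces_lt F k : F \in faces -> k \in F -> (k < 5)%N.
Proof.
by rewrite !inE; do ![case/orP]; move/eqP->; rewrite !inE => /or3P[] /eqP->.
Qed.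

Lemma uniq_face F : F \in faces -> uniq F /\ size F = 3%N.
Proof. by rewrite !inE; do ![case/orP]; move/eqP->. Qed.

Section Frame.
Variables (W : finType) (tau : W -> pred nat).

(** For distinct [i] and [j], the sum exceeds 1 unless they are the two
    nonadjacent points 0 and 1. *)
Definition frame_adj : rel ('I_5 + W)%type := fun x y =>
  match x, y with
  | inl i, inl j => (i != j) && (1 < i + j)%N
  | inl i, inr w | inr w, inl i => tau w i
  | inr _, inr _ => false
  end.

Lemma frame_sym : symmetric frame_adj.
Proof. by move=> [i|w] [j|w'] //=; rewrite eq_sym addnC. Qed.

Lemma frame_irr : irreflexive frame_adj.
Proof. by move=> [i|w] //=; rewrite eqxx. Qed.

Definition frame := SGraph frame_sym frame_irr.

Hypothesis tau_face : forall w, exists2 F, F \in faces & {subset tau w <= F}.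
Hypothesis tau_uniq : forall w w' F, F \in faces ->
  all (tau w) F -> all (tau w') F -> w = w'.

Variable R : realType.

Let centred w := has (all (tau w)) faces.
(** A hub with corners [a], [b], [c] gets the coordinates (1, 1, level) / (2 +
    level).  A hub joined to all three corners is the barycentre; it is the
    only one of its face.  The other hubs are joined at most to [a] and [b], and
    distinct levels make the paths from [a] to [b] through them disjoint: on
    such a path the smallest coordinate is [level] times the middle one. *)
Let level w : R := if centred w then 1 else (enum_rank w).+2%:R^-1.

Lemma level_gt0 w : 0 < level w.
Proof. by rewrite /level; case: ifP. Qed.

Lemma level_le1 w : level w <= 1.
Proof. by rewrite /level; case: ifP => // _; rewrite invf_le1 ?ler1n. Qed.

Lemma corners_exist w : exists abc : nat * nat * nat,
  let: (a, b, c) := abc in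
  [/\ exists2 F, F \in faces & perm_eq [:: a; b; c] F,
      {subset tau w <= [:: a; b; c]} & tau w c -> centred w].
Proof.
have [F FF wF] := tau_face w.
have [wall|/allPn[c cF wc]] := boolP (all (tau w) F).
  have cw : centred w by apply/hasP; exists F.
  move: FF wF; rewrite !inE; do ![case/orP]; move/eqP->; eexists (_, _, _);
  by split; [eexists; [|exact: perm_refl]|exact: wF|].
have [uF sF] := uniq_face FF.
have := perm_to_rem cF; have := size_rem cF; rewrite sF.
case: (rem c F) => [|a [|b [|]]] //= _ pF.
exists (a, b, c); split; last by move=> wc'; rewrite wc' in wc.
  by exists F; rewrite // perm_sym (perm_trans pF) // (perm_catC [:: c] [:: a; b]).
move=> k /wF kF; rewrite -(perm_mem (_ : perm_eq F _)) //.
by rewrite (perm_trans pF) // (perm_catC [:: c] [:: a; b]).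
Qed.

Let corners w : nat * nat * nat := projT1 (cid (corners_exist w)).
Let ca w := (corners w).1.1.
Let cb w := (corners w).1.2.
Let cc w := (corners w).2.
Let face w := [:: ca w; cb w; cc w].

Lemma cornersP w : [/\ exists2 F, F \in faces & perm_eq (face w) F,
  {subset tau w <= face w} & tau w (cc w) -> centred w].
Proof.
rewrite /face /ca /cb /cc /corners; case: cid => -[[a b] c] /=; exact.
Qed.

Lemma face_uniq w : uniq (face w).
Proof.
have [[F /uniq_face[uF _] /perm_uniq->] _ _] := cornersP w; exact: uF.
Qed.

Lemma face_lt w k : k \in face w -> (k < 5)%N.
Proof.
by have [[F FF /perm_mem->] _ _] := cornersP w; exact: faces_lt.
Qed.

(** The coordinates of the point at the fraction [t] of the edge from the hub
    [w] to the corner [i].  The middle coordinate [s] belongs to [j]. *)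
Let hub_point w i t (m : nat -> R) := let s := (1 - t) / (2 + level w) in
  exists j k, [/\ perm_eq [:: k; j; i] (face w), 0 <= t < 1,
    [/\ m k = level w * s, m j = s & m i = s + t] &
    forall n, n \notin face w -> m n = 0].

Lemma hub_point_scale w t : 0 <= t < 1 -> 0 < (1 - t) / (2 + level w).
Proof.
by move=> t01; rewrite divr_gt0 //; have := level_gt0 w; lra.
Qed.

Lemma hub_point_support w i t m : hub_point w i t m ->
  forall n, (0 < m n) = (n \in face w).
Proof.
case=> j [k [p t01 [mk mj mi] m0]] n; have s0 := hub_point_scale w t01.
have [nf|nf] := boolP (n \in face w); last by rewrite m0 // ltxx.
move: nf; rewrite -(perm_mem p) !inE => /or3P[] /eqP->.
- by rewrite mk mulr_gt0 // level_gt0.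
- by rewrite mj.
- by rewrite mi; apply/idP; lra.
Qed.

Lemma hub_point_carried w i t m : hub_point w i t m ->
  exists2 F, F \in faces & carried F m.
Proof.
move=> hp; have [[F FF pF] _ _] := cornersP w; exists F => //.
have [j [k [p t01 [mk mj mi] m0]]] := hp.
have supp := hub_point_support hp.
split.
- move=> n; have [/m0->//|] := boolP (n \notin face w).
  by rewrite negbK -supp => /ltW.
- by move=> n; rewrite -(perm_mem pF) => /m0.
- have l2 : 2 + level w != 0 by apply: lt0r_neq0; have := level_gt0 w; lra.
  have tot : m k + m j + m i = 1 by rewrite mk mj mi; field.
  have : \sum_(n <- iota 0 5) m n = \sum_(n <- [:: k; j; i]) m n.
    set r5 := iota 0 5; rewrite (bigID (mem (face w))) /= [X in _ + X]big1 ?addr0;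
      last by move=> n /m0.
    rewrite -big_filter; apply: perm_big.
    rewrite perm_sym (perm_trans p) //; apply: uniq_perm.
    + exact: face_uniq.
    + by rewrite filter_uniq ?iota_uniq.
    + move=> n; rewrite mem_filter /r5 mem_iota /= add0n.
      by case: (boolP (n \in face w)) => [/face_lt->|].
  by rewrite !big_cons !big_nil /= !addr0 !addrA tot => ->.
Qed.

(** The list on the right is sorted, so the point determines it, and hence
    [level w] and [t]. *)
Lemma hub_point_profile w i t m : hub_point w i t m ->
  perm_eq [seq m n | n <- iota 0 5]
    [:: 0; 0; level w * ((1 - t) / (2 + level w)); (1 - t) / (2 + level w);
        (1 - t) / (2 + level w) + t].
Proof.
case=> j [k [p t01 [mk mj mi] m0]].
pose rest := [seq n <- iota 0 5 | n \notin face w].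
have pr : perm_eq (iota 0 5) (rest ++ [:: k; j; i]).
  rewrite -(perm_filterC (mem (face w))) perm_catC perm_cat2l.
  rewrite perm_sym (perm_trans p) //; apply: uniq_perm.
  + exact: face_uniq.
  + by rewrite filter_uniq ?iota_uniq.
  + move=> n; rewrite mem_filter mem_iota /= add0n.
    by case: (boolP (n \in face w)) => [/face_lt->|].
apply: perm_trans (perm_map m pr) _; rewrite map_cat /= mk mj mi.
have : size rest = 2%N by move: (perm_size pr); rewrite size_cat /= addn3 => -[].
have : all (fun n => m n == 0) rest.
  by apply/allP => n; rewrite mem_filter => /andP[/m0-> _].
by case: rest {pr} => [|x [|y []]] //= /and3P[/eqP-> /eqP-> _].
Qed.

Lemma all_corners w : centred w -> all (tau w) (face w).
Proof.
case/hasP => F FF /allP wF; have [_ sub _] := cornersP w.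
have [uF sF] := uniq_face FF.
have FE : F =i face w.
  by have [] := uniq_min_size uF (fun k kF => sub k (wF k kF)); rewrite ?sF.
by apply/allP => k; rewrite -FE => /wF.
Qed.

(** The profile gives the level and [t], and the support gives the face; these
    determine the hub.  If the edges end at different corners [i] and [i'], then
    [t] vanishes, because the coordinate at [i] exceeds the middle one by [t]. *)
Lemma hub_points_meet w i t m w' i' t' m' :
  hub_point w i t m -> hub_point w' i' t' m' ->
  (forall n, (n < 5)%N -> m n = m' n) -> [/\ w = w', t = t' & 0 < t -> i = i'].
Proof.
move=> hp hp' mm.
have [j [k [p t01 [mk mj mi] m0]]] := hp.
have [j' [k' [p' t01' [mk' mj' mi'] m0']]] := hp'.
have := hub_point_profile hp; rewrite perm_sym => pr.
have {pr} := perm_trans pr (perm_trans _ (hub_point_profile hp')).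
rewrite (_ : [seq m n | n <- iota 0 5] = [seq m' n | n <- iota 0 5]); last first.
  by apply/eq_in_map => n; rewrite mem_iota => /mm.
have s0 := hub_point_scale w t01; have s0' := hub_point_scale w' t01'.
move: mk mj mi mk' mj' mi'.
set s := (1 - t) / _ in s0 *; set s' := (1 - t') / _ in s0' *.
move=> mk mj mi mk' mj' mi' /(_ (perm_refl _)) pr.
have srt x (v : W) y : 0 < x -> 0 <= y -> sorted <=%R [:: 0; 0; level v * x; x; x + y].
  move=> x0 y0; rewrite /= lexx mulr_ge0 ?(ltW (level_gt0 v)) ?(ltW x0) //=.
  by rewrite ler_piMl ?level_le1 ?(ltW x0) // lerDl y0.
have [t0 t1] := andP t01; have [t0' t1'] := andP t01'.
have [El Es] := sorted_eq le_trans le_anti (srt s w t s0 t0) (srt s' w' t' s0' t0') pr.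
rewrite Es in El * => /addrI Et.
have {}El : level w = level w' by apply: (mulIf (lt0r_neq0 s0')).
have face_eq : face w =i face w'.
  move=> n; rewrite -(hub_point_support hp) -(hub_point_support hp').
  case: (ltnP n 5) => [/mm->//|n5].
  rewrite (hub_point_support hp) (hub_point_support hp').
  by rewrite !(contraNF (@face_lt _ _)) // -leqNgt.
have ww : w = w'.
  move: El; rewrite /level; case: ifPn => cw; case: ifPn => cw'.
  - have [[F FF /perm_mem pF] _ _] := cornersP w => _.
    apply: (tau_uniq FF); first by rewrite -(eq_all_r pF) all_corners.
    rewrite -(eq_all_r pF); have := all_corners cw'.
    by rewrite (eq_all_r face_eq).
  - by move/eqP; rewrite eq_sym invr_eq1 pnatr_eq1.
  - by move/eqP; rewrite invr_eq1 pnatr_eq1.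
  - by move/invr_inj/eqP; rewrite eqr_nat => /eqP[] /ord_inj /enum_rank_inj.
split=> // tp; apply/eqP/negPn/negP => ii'.
have i'f : i' \in face w by rewrite face_eq -(perm_mem p') !inE eqxx !orbT.
have ls : level w * s <= s by rewrite ler_piMl ?level_le1 // ltW.
have := mm i' (face_lt i'f); rewrite mi' -Es -Et.
move: i'f; rewrite -(perm_mem p) !inE [i' == i]eq_sym (negPf ii') orbF.
by case/orP => /eqP->; rewrite ?mk ?mj => ?; lra.
Qed.

Let coord (v : frame) (n : nat) : R := match v with
  | inl i => (n == i)%:R
  | inr w => if (n == ca w) || (n == cb w) then (2 + level w)^-1
             else if n == cc w then level w / (2 + level w) else 0
  end.

Let mixc t (m m' : nat -> R) n := (1 - t) * m n + t * m' n.

Lemma hub_edge_point w (i : nat) t m : i = ca w \/ tau w i -> 0 <= t < 1 ->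
  m =1 mixc t (coord (inr w)) (fun n => (n == i)%:R) -> hub_point w i t m.
Proof.
move=> wi t01 mE.
have /= := face_uniq w; rewrite !inE negb_or andbT => /andP[/andP[ab ac] bc].
have [_ sub cen] := cornersP w.
have m0 n : n \notin face w -> n != i -> m n = 0.
  rewrite !inE !negb_or mE /mixc /= => /and3P[/negPf-> /negPf-> /negPf->] /negPf->.
  by rewrite !mulr0 addr0.
have iF : i \in face w by case: wi => [->|/sub//]; rewrite !inE eqxx.
have {}m0 n : n \notin face w -> m n = 0.
  by move=> nf; apply: m0 => //; apply: contra nf => /eqP->.
have ma : (ca w == ca w) || (ca w == cb w) by rewrite eqxx.
have mb : (cb w == ca w) || (cb w == cb w) by rewrite eqxx orbT.
have mc : (cc w == ca w) || (cc w == cb w) = false.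
  by rewrite ![cc w == _]eq_sym (negPf ac) (negPf bc).
have icase : i \in [:: cb w; ca w] \/ i = cc w.
  by move: iF; rewrite !inE => /or3P[]/eqP->; rewrite ?eqxx ?orbT; by [left|right].
case: icase => [iab|ic].
  pose j := if i == ca w then cb w else ca w.
  exists j, (cc w).
  have pj : perm_eq [:: j; i] [:: ca w; cb w].
    move: iab; rewrite /j !inE => /orP[] /eqP->; last by rewrite eqxx (perm_catC [:: _]).
    by rewrite eq_sym (negPf ab).
  have jab : (j == ca w) || (j == cb w).
    by rewrite /j; case: ifP; rewrite ?eqxx ?orbT.
  have ij : j != i.
    by rewrite /j; case: (i =P ca w) => [->|/eqP]; rewrite eq_sym.
  have iab' : (i == ca w) || (i == cb w) by move: iab; rewrite !inE orbC.
  have ci : cc w != i by apply: contraTneq iab' => <-; rewrite mc.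
  split=> //.
    by rewrite perm_sym (perm_catC [:: ca w; cb w] [:: cc w]) /= perm_cons perm_sym.
  rewrite !mE /mixc /= mc eqxx jab iab' (negPf ij) (negPf ci) eqxx /=.
  by split; ring.
have [iab|wc] : (i == ca w) \/ tau w (cc w).
  by case: wi => [->|]; rewrite ?eqxx -?ic; [left|right].
  by move: ac; rewrite -(eqP iab) -ic eqxx.
have l1 : level w = 1 by rewrite /level cen.
exists (cb w), (ca w); split=> //; first by rewrite ic.
rewrite !mE /mixc /= ma mb ic mc eqxx (negPf ac) (negPf bc) l1 /=.
by split; ring.
Qed.

Lemma hub_vertex_point w : hub_point w (ca w) 0 (coord (inr w)).
Proof.
apply: hub_edge_point; [by left|by rewrite lexx ltr01|].
by move=> n; rewrite /mixc subr0 mul1r mul0r addr0.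
Qed.

Lemma point_edge_face (i j : 'I_5) : (1 < i + j)%N || (i == j) ->
  exists2 F, F \in faces & (val i \in F) && (val j \in F).
Proof.
move=> ij; suff /hasP[F FF ?] : has (fun F => (val i \in F) && (val j \in F)) faces.
  by exists F.
by move: ij; case: i => [[|[|[|[|[|i]]]]] hi] //; case: j => [[|[|[|[|[|j]]]]] hj].
Qed.

Lemma carried_mix t (i j : 'I_5) : 0 <= t <= 1 -> (1 < i + j)%N || (i == j) ->
  exists2 F, F \in faces & carried F (mixc t (coord (inl i)) (coord (inl j))).
Proof.
move=> /andP[t0 t1] /point_edge_face[F FF /andP[iF jF]]; exists F => //.
have delta_sum (k : 'I_5) (x : R) :
    x * (0%N == k)%:R + x * (1%N == k)%:R + x * (2%N == k)%:R +
    x * (3%N == k)%:R + x * (4%N == k)%:R = x.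
  by case: k => [[|[|[|[|[|k]]]]] hk] //=; rewrite ?mulr0 ?mulr1 ?addr0 ?add0r.
split.
- by move=> n; rewrite addr_ge0 // mulr_ge0 // subr_ge0.
- move=> n nF; rewrite /mixc /=.
  have /negPf-> : n != i by apply: contraNneq nF => ->.
  have /negPf-> : n != j by apply: contraNneq nF => ->.
  by rewrite !mulr0 addr0.
- rewrite /mixc /=; have := delta_sum i (1 - t); have := delta_sum j t; lra.
Qed.

Lemma coord_carried v : exists2 F, F \in faces & carried F (coord v).
Proof.
case: v => [i|w]; last exact: hub_point_carried (hub_vertex_point w).
have ii : (1 < i + i)%N || (i == i) by rewrite eqxx orbT.
have [|F FF [c0 cF c1]] := @carried_mix 0 i i _ ii; first by rewrite lexx ler01.
exists F => //.
have E n : mixc 0 (coord (inl i)) (coord (inl i)) n = coord (inl i) n.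
  by rewrite /mixc subr0 mul1r mul0r addr0.
split; first by move=> n; rewrite -E; exact: c0.
  by move=> n /cF; rewrite E.
by move: c1; rewrite !E.
Qed.

(** A point inside the edge [e]: the support tells whether [e] joins two points
    or belongs to a hub. *)
Let inside_edge (e : {set frame}) (m : nat -> R) :=
  (exists i j : 'I_5, [/\ i != j, e = [set inl i; inl j]%SET &
     forall n, (0 < m n) = (n \in [:: val i; val j])]) \/
  (exists w (i : 'I_5) t, [/\ e = [set inr w; inl i]%SET, 0 < t & hub_point w i t m]).

Lemma inside_edgeP (x y : frame) t : adj x y -> 0 < t < 1 ->
  let m := mixc t (coord x) (coord y) in
  inside_edge [set x; y]%SET m /\ exists2 F, F \in faces & carried F m.
Proof.
move=> xy /andP[t0 t1] m.
have hub w (i : 'I_5) s : tau w i -> 0 < s < 1 ->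
    let m := mixc s (coord (inr w)) (coord (inl i)) in
    hub_point w i s m /\ exists2 F, F \in faces & carried F m.
  move=> wi /andP[s0 s1] m'; have hp : hub_point w i s m'.
    by apply: hub_edge_point => //; [right|rewrite ltW].
  by split=> //; exact: hub_point_carried hp.
case: x y xy @m => [i|w] [j|w'] //= xy.
- move/andP: xy => [ij ij1]; split; last first.
    by apply: carried_mix; rewrite ?ij1 // !ltW.
  left; exists i, j; split=> // n; rewrite /mixc /= !inE.
  have [->|ni] := eqVneq n i.
    by rewrite (inj_eq val_inj) (negPf ij) mulr0 addr0 mulr1 subr_gt0.
  by rewrite mulr0 add0r; case: eqP => _; rewrite ?mulr1 ?mulr0 ?ltxx.
- have t01 : 0 < 1 - t < 1 by lra.
  have [hp [F FF cF]] := hub w' i (1 - t) xy t01.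
  have E n : mixc (1 - t) (coord (inr w')) (coord (inl i)) n =
             mixc t (coord (inl i)) (coord (inr w')) n by rewrite /mixc; ring.
  have {E} /funext E := E; rewrite E in hp cF.
  split; last by exists F.
  right; exists w', i, (1 - t); rewrite finset.setUC; split=> //; lra.
- have [hp cF] := hub w j t xy (introT andP (conj t0 t1)).
  by split=> //; right; exists w, j, t.
Qed.

Lemma face_not_small w (s : seq nat) : {subset face w <= s} -> (2 < size s)%N.
Proof. exact: uniq_leq_size (face_uniq w). Qed.

Lemma supp_vertex (k : 'I_5) n : (0 < coord (inl k) n) = (n \in [:: val k]).
Proof. by rewrite /= inE; case: eqP => _; rewrite ?ltr01 ?ltxx. Qed.

Lemma inside_edge_vertex e (v : frame) m :
  inside_edge e m -> (forall n, (n < 5)%N -> m n = coord v n) -> False.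
Proof.
case=> [[i [j [ij _ supp]]]|[w [i [t [_ t0 hp]]]]]; case: v => [k|w'] mv.
- have sub n : n \in [:: val i; val j] -> n \in [:: val k].
    move=> nij; rewrite -supp_vertex -mv ?supp //.
    by move: nij; rewrite !inE => /orP[]/eqP->; exact: ltn_ord.
  have := uniq_leq_size _ sub; rewrite /= inE (inj_eq val_inj) ij.
  by move/(_ isT).
- have sup' := hub_point_support (hub_vertex_point w').
  suff /face_not_small : {subset face w' <= [:: val i; val j]} by [].
  by move=> n nf; rewrite -supp mv ?(face_lt nf) // sup'.
- suff /face_not_small : {subset face w <= [:: val k]} by [].
  move=> n nf; rewrite -supp_vertex -mv ?(face_lt nf) //.
  by rewrite (hub_point_support hp).
- have [_ t'0 _] := hub_points_meet hp (hub_vertex_point w') mv.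
  by move: t0; rewrite t'0 ltxx.
Qed.

Lemma inside_edge_uniq e e' m m' : inside_edge e m -> inside_edge e' m' ->
  (forall n, (n < 5)%N -> m n = m' n) -> e = e'.
Proof.
case=> [[i [j [ij -> supp]]]|[w [i [t [-> t0 hp]]]]];
  case=> [[i' [j' [ij' -> supp']]]|[w' [i' [t' [-> t'0 hp']]]]] mm.
- have E (k : 'I_5) : (k \in [:: i; j]) = (k \in [:: i'; j']).
    by have := supp k; rewrite mm // supp' !inE !(inj_eq val_inj) => <-.
  have := E i; have := E j; rewrite !inE !eqxx orbT /=.
  move=> /esym/orP[]/eqP jE /esym/orP[]/eqP iE; move: ij; rewrite iE jE ?eqxx //.
  by move=> _; exact: finset.setUC.
- suff /face_not_small : {subset face w' <= [:: val i; val j]} by [].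
  by move=> n nf; rewrite -supp mm ?(face_lt nf) // (hub_point_support hp').
- suff /face_not_small : {subset face w <= [:: val i'; val j']} by [].
  by move=> n nf; rewrite -supp' -mm ?(face_lt nf) // (hub_point_support hp).
- have [-> _ /(_ t0) ii'] := hub_points_meet hp hp' mm.
  by have -> : i = i' by exact: val_inj.
Qed.

Theorem frame_planar : planar R frame.
Proof.
pose pos v := place (coord v).
have posE t x y : mix t (pos x) (pos y) = place (mixc t (coord x) (coord y)).
  by rewrite /mix /pos /place /mixc; congr (_, _) => /=; ring.
have same m m' : (exists2 F, F \in faces & carried F m) ->
    (exists2 F, F \in faces & carried F m') -> place m = place m' ->
    forall n, (n < 5)%N -> m n = m' n.
  by move=> [F FF cF] [F' FF' cF']; exact: place_inj FF FF' cF cF'.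
apply: (@straight_planar _ _ pos).
- move=> x y /same E; have {}E := E (coord_carried x) (coord_carried y).
  case: x y E => [i|w] [j|w'] E.
  + have := supp_vertex j i; rewrite -E // supp_vertex !inE eqxx.
    by move/esym/eqP/val_inj->.
  + suff /face_not_small : {subset face w' <= [:: val i]} by [].
    move=> n nf; rewrite -supp_vertex E ?(face_lt nf) //.
    by rewrite (hub_point_support (hub_vertex_point w')).
  + suff /face_not_small : {subset face w <= [:: val j]} by [].
    move=> n nf; rewrite -supp_vertex -E ?(face_lt nf) //.
    by rewrite (hub_point_support (hub_vertex_point w)).
  + by have [->] := hub_points_meet (hub_vertex_point w) (hub_vertex_point w') E.
- move=> x y z t xy t01; rewrite posE => /same E.
  have [ie cm] := inside_edgeP xy t01.
  exact: inside_edge_vertex ie (E cm (coord_carried z)).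
- move=> x y z w t s xy zw t01 s01; rewrite !posE => /same E.
  have [ie cm] := inside_edgeP xy t01; have [ie' cm'] := inside_edgeP zw s01.
  exact: inside_edge_uniq ie ie' (E cm cm').
Qed.

End Frame.

Local Open Scope nat_scope.

(** * Proper minors are 3-apex *)

Section Subgraphs.
Variable R : realType.

Lemma planar_subgraph (H G : sgraph) : subgraph H G -> planar R G -> planar R H.
Proof.
case=> f [f_inj f_adj] [pos [arc [pos_inj arcP vert cross]]].
have fU x y : f @: [set x; y]%SET = [set f x; f y]%SET.
  by rewrite imsetU1 imset_set1.
have fE e : e \in edges H -> f @: e \in edges G.
  rewrite !inE => /existsP[x /existsP[y /andP[xy /eqP->]]].
  by apply/existsP; exists (f x); apply/existsP; exists (f y); rewrite f_adj // fU eqxx.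
exists (pos \o f), (fun e : {set H} => arc (f @: e)%SET); split.
- exact: inj_comp.
- by move=> x y xy; rewrite fU; apply: arcP; exact: f_adj.
- by move=> e x /fE eE /(vert _ _ eE); rewrite mem_imset.
- move=> e e' eE eE' ee' p pe pe'.
  have [|y] := cross _ _ (fE _ eE) (fE _ eE') _ p pe pe'.
    by rewrite (inj_eq (imset_inj f_inj)).
  rewrite inE => /andP[/imsetP[x xe ->] fxe'] px; exists x => //.
  by rewrite inE xe /=; rewrite mem_imset in fxe'.
Qed.

Lemma apex_subgraph n (H G : sgraph) : subgraph H G -> apex R n G -> apex R n H.
Proof.
case=> f [f_inj f_adj] [S Sn pS]; exists (f @^-1: S)%SET.
  apply: leq_trans Sn; rewrite -(card_imset _ f_inj); apply: subset_leq_card.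
  by apply/fintype.subsetP => _ /imsetP[x + ->]; rewrite inE.
apply: planar_subgraph pS.
have sub (x : delete (f @^-1: S)%SET) : f (val x) \notin S.
  by have := valP x; rewrite inE.
exists (fun x => Sub (f (val x)) (sub x)); split.
  by move=> x y /(congr1 val) /f_inj/val_inj.
by move=> x y; rewrite /= /delete_adj !SubK; exact: f_adj.
Qed.

Section Label.
Variables (G : sgraph) (S : {set G}) (label : G -> nat).

Let sees w : pred nat := fun k => [exists x, [&& x \notin S, label x == k & adj w x]].

Hypothesis label_inj : forall x y, x \notin S -> y \notin S ->
  label x < 5 -> label x = label y -> x = y.
Hypothesis label_hub : forall x y, x \notin S -> y \notin S ->
  5 <= label x -> 5 <= label y -> adj x y = false.
Hypothesis label_01 : forall x y, x \notin S -> y \notin S ->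
  label x = 0 -> label y = 1 -> adj x y = false.
Hypothesis sees_face : forall w, w \notin S -> 5 <= label w ->
  [&& ~~ (sees w 0 && sees w 1), ~~ [&& sees w 2, sees w 3 & sees w 4] &
      ~~ [&& sees w 0, sees w 2 & sees w 3]].
Hypothesis sees_uniq : forall w w' F, w \notin S -> w' \notin S ->
  5 <= label w -> 5 <= label w' -> F \in faces ->
  all (sees w) F -> all (sees w') F -> w = w'.

(** The graph is mapped to a frame by its labels, where a label above 4 marks a
    hub.  A set of labels lies in a face unless it contains 0 and 1, or all of
    2, 3, 4, or all of 0, 2, 3. *)
Lemma delete_planar : planar R (delete S).
Proof.
pose tau (w : delete S) : pred nat :=
  fun k => (5 <= label (val w)) && sees (val w) k.
have tau_face w : exists2 F, F \in faces & {subset tau w <= F}.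
  have [lw|lw] := leqP 5 (label (val w)); last first.
    by exists [:: 1; 2; 3] => // k; rewrite unfold_in /tau leqNgt lw.
  have s5 k : sees (val w) k -> k < 5.
    case/existsP=> x /and3P[xS /eqP<- wx]; rewrite ltnNge; apply/negP => lx.
    by rewrite label_hub ?(valP w) in wx.
  have [] := and3P (sees_face (valP w) lw).
  case E0: (sees (val w) 0); case E1: (sees (val w) 1);
  case E2: (sees (val w) 2); case E3: (sees (val w) 3);
  case E4: (sees (val w) 4) => //= _ _ _;
  (suff /hasP[F FF /allP wF] : has (fun F => all (fun k => sees (val w) k ==> (k \in F))
       (iota 0 5)) faces by
    exists F => // k; rewrite unfold_in => /andP[_ wk];
    have := wF k; rewrite mem_iota wk => /(_ (s5 _ wk)));
  by rewrite /= E0 E1 E2 E3 E4.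
have tau_uniq w w' F : F \in faces -> all (tau w) F -> all (tau w') F -> w = w'.
  move=> FF wF wF'.
  have [k kF] : exists k, k \in F.
    by move: FF; rewrite !inE; do ![case/orP]; move/eqP->; eexists; exact: mem_head.
  have /andP[lw _] := allP wF _ kF; have /andP[lw' _] := allP wF' _ kF.
  apply: val_inj; apply: sees_uniq (valP w) (valP w') lw lw' FF _ _.
    by apply: sub_all wF => n /andP[].
  by apply: sub_all wF' => n /andP[].
apply: planar_subgraph (frame_planar tau_face tau_uniq R).
pose f (x : delete S) : frame tau :=
  if label (val x) < 5 then inl (inord (label (val x))) else inr x.
exists f; split.
  move=> x y; rewrite /f; case: ltnP => lx; case: ltnP => ly //; last by case.
  case=> /(congr1 val); rewrite /= !inordK // => xy.
  exact/val_inj/(label_inj (valP x) (valP y) lx xy).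
move=> x y xy; rewrite /f; case: ltnP => lx; case: ltnP => ly.
- rewrite /= -val_eqE /= !inordK //; apply/andP; split.
    apply: contraTneq xy => /(label_inj (valP x) (valP y) lx)/val_inj->.
    by rewrite adj_irr.
  rewrite ltnNge; apply/negP; move: xy; rewrite /= /delete_adj.
  case Ex: (label (val x)) => [|[|n]]; case Ey: (label (val y)) => [|[|m]] //= xy _.
  + have E := label_inj (valP x) (valP y) lx (etrans Ex (esym Ey)).
    by move: xy; rewrite E adj_irr.
  + by rewrite label_01 ?(valP x) ?(valP y) in xy.
  + by rewrite adj_sym label_01 ?(valP x) ?(valP y) in xy.
- rewrite /= /tau ly inordK //=; apply/existsP; exists (val x).
  by rewrite (valP x) eqxx /= adj_sym.
- rewrite /= /tau lx inordK //=; apply/existsP; exists (val y).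
  by rewrite (valP y) eqxx.
- by move: xy; rewrite /= /delete_adj label_hub ?(valP x) ?(valP y).
Qed.
End Label.
End Subgraphs.

(** The points are listed, and labelled in order from [d] on. *)
Section ListLabel.
Variables (R : realType) (G : sgraph) (S : {set G}) (d : nat) (ps : seq G).
Hypotheses (ps_uniq : uniq ps) (ps_size : d + size ps <= 5).

Let seen w k := (d <= k) && (k - d < size ps) && adj w (nth w ps (k - d)).

Hypothesis hub_apart : forall w w', w \notin S -> w' \notin S ->
  w \notin ps -> w' \notin ps -> adj w w' = false.
Hypothesis apart_01 : forall x, d = 0 -> 1 < size ps -> adj (nth x ps 0) (nth x ps 1) = false.
Hypothesis seen_face : forall w, w \notin S -> w \notin ps ->
  [&& ~~ (seen w 0 && seen w 1), ~~ [&& seen w 2, seen w 3 & seen w 4] &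
      ~~ [&& seen w 0, seen w 2 & seen w 3]].
Hypothesis seen_uniq : forall w w' F, w \notin S -> w' \notin S ->
  w \notin ps -> w' \notin ps -> F \in faces ->
  all (seen w) F -> all (seen w') F -> w = w'.

Lemma delete_list_planar : planar R (delete S).
Proof.
pose label x := if x \in ps then d + index x ps else 5.
have lt5 x : x \in ps -> label x < 5.
  move=> xp; rewrite /label xp; apply: leq_trans ps_size.
  by rewrite ltn_add2l index_mem.
have hubE x : (5 <= label x) = (x \notin ps).
  by case: (boolP (x \in ps)) => [/lt5|/negPf xp];
    [rewrite ltnNge => /negbTE|rewrite /label xp].
have seesE w k : w \notin S -> k < 5 ->
    [exists x, [&& x \notin S, label x == k & adj w x]] -> seen w k.
  move=> wS k5 /existsP[x /and3P[xS /eqP xk wx]].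
  have xp : x \in ps by rewrite -[_ \in _]negbK -hubE xk -ltnNge.
  move: xk; rewrite /label xp => <-.
  by rewrite /seen leq_addr addKn index_mem xp nth_index.
apply: (@delete_planar R G S label).
- move=> x y xS yS; rewrite ltnNge hubE negbK => xp xy.
  have yp : y \in ps by rewrite -[_ \in _]negbK -hubE -xy hubE xp.
  move: xy; rewrite /label xp yp => /addnI xy.
  by rewrite -(nth_index x xp) -[in RHS](nth_index x yp) xy.
- by move=> x y xS yS; rewrite !hubE; exact: hub_apart.
- move=> x y xS yS; rewrite /label; case: ifP => // xp; case: ifP => // yp.
  move=> /eqP; rewrite addn_eq0 => /andP[/eqP d0 /eqP x0]; rewrite d0 add0n => y1.
  rewrite -(nth_index x xp) -(nth_index x yp) x0 y1 apart_01 //.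
  by rewrite -y1 index_mem.
- move=> w wS; rewrite hubE => wp; have /and3P[h1 h2 h3] := seen_face wS wp.
  apply/and3P; split.
  + by apply: contra h1 => /andP[/(seesE _ _ wS)-> // /(seesE _ _ wS)->].
  + by apply: contra h2 => /and3P[/(seesE _ _ wS)-> // /(seesE _ _ wS)-> // /(seesE _ _ wS)->].
  + by apply: contra h3 => /and3P[/(seesE _ _ wS)-> // /(seesE _ _ wS)-> // /(seesE _ _ wS)->].
- move=> w w' F wS wS'; rewrite !hubE => wp wp' FF wF wF'.
  apply: (seen_uniq wS wS' wp wp' FF); apply/allP => k kF.
    exact: seesE wS (faces_lt FF kF) (allP wF _ kF).
  exact: seesE wS' (faces_lt FF kF) (allP wF' _ kF).
Qed.

End ListLabel.

Section Apex.
Variables (R : realType) (G : sgraph).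

(** The labels are 1 to 4.  The neighbours of the hub that sees three points, if
    there is one, come first, so that their labels are not 2, 3, 4. *)
Lemma four_core_apex (S Q : {set G}) : #|S| <= 3 -> four_core S Q -> apex R 3 G.
Proof.
move=> S3 [indep card4 deg uq]; exists S => //.
pose D := [set y in Q | [exists w, [&& w \notin S :|: Q, 2 < #|nbhd w :&: Q| & adj w y]]]%SET.
have DQ : D \subset Q by apply/fintype.subsetP => y; rewrite inE => /andP[].
have D3 : #|D| <= 3.
  have [->|[y]] := set_0Vmem D; first by rewrite cards0.
  rewrite inE => /andP[_ /existsP[w /and3P[wS w3 _]]].
  apply: leq_trans (deg _ wS); apply: subset_leq_card; apply/fintype.subsetP => z.
  rewrite !inE => /andP[-> /existsP[w' /and3P[wS' w3' wz]]].
  by rewrite (uq _ _ wS wS' w3 w3') wz.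
pose ps := enum D ++ enum (Q :\: D)%SET.
have mem_ps x : (x \in ps) = (x \in Q).
  rewrite mem_cat !mem_enum finset.in_setD; case: (boolP (x \in D)) => //= xD.
  by rewrite (fintype.subsetP DQ).
have ps_uniq : uniq ps.
  rewrite cat_uniq !enum_uniq /= andbT; apply/hasPn => x.
  by rewrite !mem_enum inE => /andP[].
have ps_size : size ps = #|Q|.
  rewrite -(card_uniqP ps_uniq); exact: eq_card mem_ps.
have notSQ w : w \notin S -> w \notin ps -> w \notin (S :|: Q)%SET.
  by rewrite mem_ps inE negb_or => -> ->.
have three w i j k : uniq [:: i; j; k] ->
   all (fun n => (n < size ps) && adj w (nth w ps n)) [:: i; j; k] ->
   2 < #|nbhd w :&: Q|.
  rewrite /= !inE negb_or !andbT => /andP[/andP[ij ik] jk].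
  case/and3P=> /andP[li wi] /andP[lj wj] /andP[lk wk].
  apply/card_gt2P; exists (nth w ps i), (nth w ps j), (nth w ps k).
  rewrite !inE wi wj wk -!mem_ps !mem_nth //; split=> //.
  by rewrite !nth_uniq // ij jk eq_sym.
apply: (@delete_list_planar R G S 1 ps) => //.
- by rewrite ps_size.
- by move=> w w' wS wS' /(notSQ _ wS) + /(notSQ _ wS'); exact: indep.
- move=> w wS /(notSQ _ wS) wSQ; rewrite /= !subn1 /=; apply/andP; split=> //.
  apply/negP => /and3P[/andP[l1 w1] /andP[l2 w2] /andP[l3 w3]].
  have w3' : 2 < #|nbhd w :&: Q| by apply: (three w 1 2 3); rewrite //= l1 w1 l2 w2 l3 w3.
  have : nth w ps 3 \in D.
    rewrite inE -mem_ps mem_nth //=; apply/existsP; exists w.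
    by rewrite wSQ w3' w3.
  rewrite -mem_enum -index_mem -cardE.
  have nD : nth w ps 3 \notin enum D.
    rewrite /ps nth_cat -cardE ltnNge D3 /= mem_enum.
    have : nth w (enum (Q :\: D)%SET) (3 - #|D|) \in enum (Q :\: D)%SET.
      by apply: mem_nth; rewrite ltn_subLR // cardE -size_cat.
    by rewrite mem_enum inE => /andP[].
  by rewrite cardE index_mem (negPf nD).
- move=> w w' F wS wS' /(notSQ _ wS) wSQ /(notSQ _ wS') wSQ' FF wF wF'.
  have big v : all (fun k => (1 <= k) && (k - 1 < size ps) && adj v (nth v ps (k - 1))) F ->
      2 < #|nbhd v :&: Q|.
    move: FF; rewrite !inE; do ![case/orP]; move/eqP->; rewrite /= ?subn1 //=.
    + by move=> H; apply: (three v 0 1 2).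
    + by move=> H; apply: (three v 0 1 3).
    + by move=> H; apply: (three v 0 2 3).
  exact: uq (big _ wF) (big _ wF').
Qed.

(** The unlinked points take the labels 0 and 1. *)
Lemma five_points_apex (Q : {set G}) (x y p q r : G) :
  singly_linked Q -> #|Q| <= 8 -> {subset [:: x; y; p; q; r] <= mem Q} ->
  uniq [:: x; y; p; q; r] -> (forall l, ~~ link Q x y l) ->
  (forall w, w \notin Q -> ~~ [&& adj w p, adj w q & adj w r]) ->
  (forall w, w \notin Q -> ~~ [&& adj w x, adj w p & adj w q]) ->
  apex R 3 G.
Proof.
move=> [indep deg uq] card8 ptsQ u unl npqr nxpq.
set ps := [:: x; y; p; q; r] in ptsQ u.
pose S := (Q :\: [set z in ps])%SET.
have hubQ w : w \notin S -> w \notin ps -> w \notin Q.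
  by rewrite !inE negb_and negbK => /orP[->|->].
exists S.
  have sub : [set z in ps]%SET \subset Q.
    by apply/fintype.subsetP => z; rewrite inE; exact: ptsQ.
  by rewrite cardsDS // cardsE (card_uniqP u) leq_subLR.
apply: (@delete_list_planar R G S 0 ps) => //.
- by move=> w w' wS wS' /(hubQ _ wS) + /(hubQ _ wS'); exact: indep.
- by move=> z _ _ /=; apply/negbTE; exact: unl None.
- move=> w wS /(hubQ _ wS) wQ; rewrite /= npqr // nxpq // !andbT.
  by have := unl (Some w); rewrite /= wQ.
- move=> w w' F wS wS' /(hubQ _ wS) wQ /(hubQ _ wS') wQ' FF wF wF'.
  have [i [j [iF jF ij]]] : exists i j, [/\ i \in F, j \in F & i != j].
    by move: FF; rewrite !inE; do ![case/orP]; move/eqP->;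
       [exists 1, 2|exists 1, 2|exists 1, 3|exists 0, 2|exists 0, 3].
  have [/andP[/andP[_ +] wi] /andP[/andP[_ +] wj]] := (allP wF _ iF, allP wF _ jF).
  have [/andP[_ wi'] /andP[_ wj']] := (allP wF' _ iF, allP wF' _ jF).
  rewrite !subn0 in wi wj wi' wj' * => li lj.
  rewrite (set_nth_default w) // in wi'; rewrite (set_nth_default w) // in wj'.
  suff [] : Some w = Some w' by [].
  apply: (uq (nth w ps i) (nth w ps j)).
  + by apply: ptsQ; rewrite mem_nth.
  + by apply: ptsQ; rewrite mem_nth.
  + by rewrite nth_uniq.
  + by rewrite /= wQ wi wj.
  + by rewrite /= wQ' wi' wj'.
Qed.

(** With eight points, two of them [x] and [y] unlinked, choose [p] and [q].  At
    most one hub sees both, and it sees at most one more point.  So there is a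
    further point [r] that it does not see, and after exchanging [x] and [y] it
    does not see [x]. *)
Lemma deficient_apex (Q : {set G}) :
  singly_linked Q -> #|Q| <= 8 -> deficient Q -> apex R 3 G.
Proof.
move=> linQ card8; have [indep deg uq] := linQ.
have [lt8 _|ge8] := ltnP #|Q| 8.
  have [B BQ cardB] := subset_card_exists Q 3.
  apply: (@four_core_apex B (Q :\: B)%SET); first by rewrite cardB geq_minl.
  by apply: singly_linked_four_core => //; rewrite cardsDS // cardB; lia.
have {ge8} cardQ : #|Q| = 8 by apply/eqP; rewrite eqn_leq card8.
case=> [|[x [y [xQ yQ xy unl]]]]; first by rewrite cardQ.
have pick_point (s : seq G) : uniq s -> {subset s <= mem Q} -> size s < 8 ->
    exists z, z \in Q /\ z \notin s.
  move=> us sQ s8; have : 0 < #|Q :\: [set z in s]|.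
    rewrite cardsDS ?cardsE ?(card_uniqP us) ?cardQ ?subn_gt0 //.
    by apply/fintype.subsetP => z; rewrite inE; exact: sQ.
  by case/card_gt0P => z; rewrite !inE => /andP[zs zQ]; exists z.
have cons_sub (s : seq G) z : z \in Q -> {subset s <= mem Q} -> {subset z :: s <= mem Q}.
  by move=> zQ sQ t; rewrite inE => /orP[/eqP->|/sQ].
have sub0 : {subset [::] <= mem Q} by [].
have sub2 := cons_sub _ _ xQ (cons_sub _ _ yQ sub0).
have u2 : uniq [:: x; y] by rewrite /= inE xy.
have [p [pQ p2]] := pick_point _ u2 sub2 isT.
have sub3 := cons_sub _ _ pQ sub2.
have u3 : uniq [:: p; x; y] by rewrite cons_uniq p2.
have [q [qQ q3]] := pick_point _ u3 sub3 isT.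
have sub4 := cons_sub _ _ qQ sub3.
have u4 : uniq [:: q; p; x; y] by rewrite cons_uniq q3.
have [r1 [r1Q r14]] := pick_point _ u4 sub4 isT.
have sub5 := cons_sub _ _ r1Q sub4.
have u5 : uniq [:: r1; q; p; x; y] by rewrite cons_uniq r14.
have [r2 [r2Q r25]] := pick_point _ u5 sub5 isT.
have pq : p != q by move: q3; rewrite inE negb_or eq_sym => /andP[].
have hub_pq w w' : w \notin Q -> w' \notin Q -> adj w p -> adj w q ->
    adj w' p -> adj w' q -> w = w'.
  move=> wQ wQ' wp wq wp' wq'.
  have := uq p q (Some w) (Some w') pQ qQ pq; rewrite /= wQ wp wq wQ' wp' wq'.
  by move=> /(_ isT isT) [].
have [r [rQ r4 npqr]] : exists r, [/\ r \in Q, r \notin [:: q; p; x; y] &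
    forall w, w \notin Q -> ~~ [&& adj w p, adj w q & adj w r]].
  have [/existsP[w /and4P[wQ wp wq w1]]|/existsPn no] :=
    boolP [exists w, [&& w \notin Q, adj w p, adj w q & adj w r1]]; last first.
    by exists r1; split=> // w wQ; have := no w; rewrite wQ.
  exists r2; split=> //; first by move: r25; rewrite inE negb_or => /andP[].
  move=> w' wQ'; apply/negP => /and3P[wp' wq' w2].
  have ww := hub_pq _ _ wQ wQ' wp wq wp' wq'; subst w'.
  have : #|[set z in [:: r2; r1; q; p]]%SET| <= #|nbhd w|.
    apply: subset_leq_card; apply/fintype.subsetP => z; rewrite !inE.
    by case/or4P => /eqP->.
  have u6 : uniq [:: r2; r1; q; p; x; y] by rewrite cons_uniq r25 u5.
  by rewrite cardsE (card_uniqP (take_uniq 4 u6)) leqNgt ltnS deg.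
have u5' : uniq [:: r; q; p; x; y] by rewrite cons_uniq r4.
have uy : uniq [:: y; x; p; q; r] by rewrite -rev_uniq.
have ux : uniq [:: x; y; p; q; r].
  rewrite (perm_uniq (_ : perm_eq _ [:: y; x; p; q; r])) //.
  by rewrite (perm_cat2r [:: p; q; r] [:: x; y] [:: y; x]) (perm_catC [:: x] [:: y]).
have subx : {subset [:: x; y; p; q; r] <= mem Q}.
  by apply/allP; rewrite /= xQ yQ pQ qQ rQ.
have suby : {subset [:: y; x; p; q; r] <= mem Q}.
  by apply/allP; rewrite /= xQ yQ pQ qQ rQ.
have [/existsP[w /and4P[wQ wx wp wq]]|/existsPn no] :=
    boolP [exists w, [&& w \notin Q, adj w x, adj w p & adj w q]]; last first.
  by apply: five_points_apex linQ card8 subx ux unl npqr _ => w wQ; have := no w; rewrite wQ.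
apply: (five_points_apex linQ card8 suby uy _ npqr).
  by move=> l; have := unl l; case: l => [w'|] /=;
    [rewrite [adj w' y && _]andbC|rewrite adj_sym].
move=> w' wQ'; apply/negP => /and3P[wy wp' wq'].
have ww := hub_pq _ _ wQ wQ' wp wq wp' wq'; subst w'.
by have := unl (Some w); rewrite /= wQ wx wy.
Qed.

Lemma subfull_apex : subfull G -> apex R 3 G.
Proof.
case=> [[S [Q [S3 fQ]]]|[Q [linQ card8 dQ]]]; first exact: four_core_apex fQ.
exact: deficient_apex dQ.
Qed.

End Apex.

Theorem proper_minor_apex (R : realType) (G H : sgraph) (Q : {set G}) :
  full Q -> proper_minor H G -> apex R 3 H.
Proof.
move=> fQ /(proper_minor_subfull fQ)[H' /(subfull_apex R) aH [f [bf fadj]]].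
apply: apex_subgraph aH; have [g fK gK] := bf.
by exists g; split; [exact: can_inj gK|move=> x y; rewrite -fadj !gK].
Qed.

(** * Full graphs are not 3-apex *)

Section Joined.
Variables (R : realType) (G : sgraph) (Q S : {set G}).
Hypothesis linkedQ : singly_linked Q.
Hypothesis planarS : planar R (delete S).

Definition joined (x y : G) :=
  exists2 l, link Q x y l & if l is Some w then w \notin S else true.

Lemma drawing_off : exists (pos : G -> R * R) (arc : G -> G -> set (R * R)),
  (forall x y, x \notin S -> y \notin S -> adj x y ->
     compact (arc x y) /\ linked (arc x y) (pos x) (pos y)) /\
  (forall x y z t, x \notin S -> y \notin S -> z \notin S -> t \notin S ->
     adj x y -> adj z t -> x \notin [:: z; t] -> y \notin [:: z; t] ->
     arc x y `&` arc z t = set0).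
Proof.
have [pos [arc [pos_inj arcP vert cross]]] := planarS.
pose p x := if insub x is Some x' then pos x' else (0, 0)%R.
pose a x y := if (insub x, insub y) is (Some x', Some y') then arc [set x'; y']%SET
  else set0.
have pE x (xS : x \notin S) : p x = pos (Sub x xS) by rewrite /p insubT.
have aE x y (xS : x \notin S) (yS : y \notin S) :
    a x y = arc [set Sub x xS; Sub y yS]%SET by rewrite /a !insubT.
have edgeE x y (xS : x \notin S) (yS : y \notin S) : adj x y ->
    [set Sub x xS; Sub y yS]%SET \in edges (delete S).
  move=> xy; rewrite inE; apply/existsP; exists (Sub x xS); apply/existsP.
  by exists (Sub y yS); rewrite eqxx andbT.
exists p, a; split.
  move=> x y xS yS xy; rewrite (aE _ _ xS yS) (pE _ xS) (pE _ yS).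
  by apply: arc_linked; apply: arcP.
move=> x y z t xS yS zS tS xy zt xn yn.
rewrite (aE _ _ xS yS) (aE _ _ zS tS) -subset0 => q [q1 q2].
have apart s (sS : s \notin S) : s \notin [:: z; t] ->
    Sub s sS \notin [set Sub z zS; Sub t tS : delete S]%SET.
  by rewrite !inE -!val_eqE.
have [|s] := cross _ _ (edgeE _ _ xS yS xy) (edgeE _ _ zS tS zt) _ q q1 q2.
  apply: contraNneq (apart x xS xn) => <-; by rewrite !inE eqxx.
rewrite inE => /andP[sxy szt] _; move: sxy; rewrite !inE => /orP[]/eqP sE.
  by move: szt; rewrite sE (negPf (apart x xS xn)).
by move: szt; rewrite sE (negPf (apart y yS yn)).
Qed.

(** Each edge is drawn as the link of its ends.  Links of disjoint edges are
    disjoint, since a common hub would be adjacent to four points. *)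
Lemma joined_loosely_drawn (ps : seq G) (es : seq (nat * nat)) :
  uniq ps -> {subset ps <= mem (Q :\: S)%SET} ->
  (forall e, e \in es -> [&& e.1 < size ps, e.2 < size ps & e.1 != e.2]) ->
  (forall x0 e, e \in es -> joined (nth x0 ps e.1) (nth x0 ps e.2)) ->
  loosely_drawn R es.
Proof.
case: ps => [|x0 ps'].
  move=> _ _ small _; exists (fun=> (0, 0)%R), (fun=> set0).
  by split=> [e|e f] /small/and3P[].
set ps := x0 :: ps' => ups psP small /(_ x0) joinE.
have [pos [arc [arcP cross]]] := drawing_off.
pose v := nth x0 ps.
have /choice[l lP] : forall e : nat * nat, exists l, e \in es ->
    link Q (v e.1) (v e.2) l /\ (if l is Some w then w \notin S else true).
  move=> e; case: (boolP (e \in es)) => [ees|_]; last by exists None.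
  by have [l h1 h2] := joinE _ ees; exists l.
have vQS i : i < size ps -> v i \in Q /\ v i \notin S.
  by move=> /(mem_nth x0)/psP; rewrite inE => /andP[].
pose L e := let x := v e.1 in let y := v e.2 in
  if l e is Some w then arc x w `|` arc w y else arc x y.
have endsP e : e \in es -> [/\ v e.1 \in Q /\ v e.1 \notin S, v e.2 \in Q /\ v e.2 \notin S &
    v e.1 != v e.2].
  by move=> /small/and3P[l1 l2 l12]; split; [exact: vQS|exact: vQS|rewrite nth_uniq].
exists (pos \o v), L; split.
  move=> e ees; have [[xQ xS] [yQ yS] _] := endsP _ ees.
  have [] := lP _ ees; rewrite /L; case: (l e) => [w|] /=; last first.
    by move=> xy _; exact: arcP.
  move=> /and3P[wQ wx wy] wS.
  have [c1 k1] : compact (arc (v e.1) w) /\ linked (arc (v e.1) w) (pos (v e.1)) (pos w).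
    by apply: arcP => //; rewrite adj_sym.
  have [c2 k2] := arcP _ _ wS yS wy.
  split; first exact: compactU.
  apply: (@linked_trans _ _ _ (pos w)).
    by apply: linked_sub k1 => q; left.
  by apply: linked_sub k2 => q; right.
move=> e f ees fes /and4P[d1 d2 d3 d4].
have [[xQ xS] [yQ yS] xy] := endsP _ ees; have [[zQ zS] [tQ tS] zt] := endsP _ fes.
have /and3P[e1 e2 _] := small _ ees; have /and3P[f1 f2 _] := small _ fes.
have vneq i j : i < size ps -> j < size ps -> i != j -> v i != v j.
  by move=> si sj ij; rewrite nth_uniq.
have xz := vneq _ _ e1 f1 d1; have xt := vneq _ _ e1 f2 d2.
have yz := vneq _ _ e2 f1 d3; have yt := vneq _ _ e2 f2 d4.
have [le leS] := lP _ ees; have [lf lfS] := lP _ fes; move: le leS lf lfS.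
rewrite /L; move: (v e.1) (v e.2) (v f.1) (v f.2) xQ xS yQ yS zQ zS tQ tS xy zt xz xt yz yt.
move=> x y z t xQ xS yQ yS zQ zS tQ tS xy zt xz xt yz yt.
have hubs_differ w w' : w \notin Q -> adj w x -> adj w y -> adj w' z -> adj w' t -> w != w'.
  move=> wQ wx wy wz wt; apply/negP => /eqP ww; subst w'.
  have : #|[set s in [:: x; y; z; t]]%SET| <= #|nbhd w|.
    apply: subset_leq_card; apply/fintype.subsetP => s; rewrite !inE.
    by case/or4P => /eqP->.
  rewrite cardsE (card_uniqP _); first by rewrite leqNgt ltnS (hub_deg linkedQ wQ).
  by rewrite /= !inE !negb_or xy xz xt yz yt zt.
have hub_point w s : w \notin Q -> s \in Q -> w != s.
  by move=> wQ sQ; apply: contraNneq wQ => ->.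
have point_hub w s : w \notin Q -> s \in Q -> s != w.
  by move=> wQ sQ; rewrite eq_sym hub_point.
have apart a b c d : a \notin S -> b \notin S -> c \notin S -> d \notin S ->
    adj a b -> adj c d -> a != c -> a != d -> b != c -> b != d ->
    arc a b `&` arc c d = set0.
  move=> aS bS cS dS ab cd ac ad bc bd; apply: cross => //.
    by rewrite !inE negb_or ac.
  by rewrite !inE negb_or bc.
case: (l e) => [w|]; case: (l f) => [w'|] /=.
- move=> /and3P[wQ wx wy] wS /and3P[wQ' wz wt] wS'.
  have ww := hubs_differ _ _ wQ wx wy wz wt.
  have [xw zw'] : adj x w /\ adj z w' by split; rewrite adj_sym.
  have := (point_hub _ _ wQ' xQ, point_hub _ _ wQ' yQ).
  have := (hub_point _ _ wQ zQ, hub_point _ _ wQ tQ) => -[? ?] [? ?].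
  by rewrite classical_sets.setIUl !classical_sets.setIUr !apart // !classical_sets.setU0.
- move=> /and3P[wQ wx wy] wS zt' _.
  have xw : adj x w by rewrite adj_sym.
  have := (hub_point _ _ wQ zQ, hub_point _ _ wQ tQ) => -[? ?].
  by rewrite classical_sets.setIUl !apart // classical_sets.setU0.
- move=> xy' _ /and3P[wQ' wz wt] wS'.
  have zw' : adj z w' by rewrite adj_sym.
  have := (point_hub _ _ wQ' xQ, point_hub _ _ wQ' yQ) => -[? ?].
  by rewrite classical_sets.setIUr !apart // classical_sets.setU0.
- by move=> xy' _ zt' _; rewrite apart.
Qed.
End Joined.

Theorem full_not_apex (R : realType) (G : sgraph) (Q : {set G}) :
  full Q -> ~ apex R 3 G.
Proof.
move=> fQ [S S3 planarS].
have linkedQ := full_singly_linked fQ.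
have joinP x y : x \in Q -> y \in Q -> x != y ->
    (forall w, w \in S -> w \notin Q -> adj w x -> ~ adj w y) -> joined Q S x y.
  move=> xQ yQ xy no; have [l lk] := full_link fQ xQ yQ xy; exists l => //.
  case: l lk => [w|] //= /and3P[wQ wx wy]; apply/negP => wS.
  exact: (no w wS wQ wx wy).
have sub_enum (A : {set G}) : A \subset (Q :\: S)%SET -> {subset enum A <= mem (Q :\: S)%SET}.
  by move=> AQ x; rewrite mem_enum => /(fintype.subsetP AQ).
have [SQ|SQ] := eqVneq (S :\: Q)%SET finset.set0.
  have [P PQ P5] := subset_card_exists (Q :\: S)%SET 5.
  have P5' : size (enum P) = 5.
    rewrite -cardE P5; apply/minn_idPl; have := cardsID S Q; rewrite (full_card fQ).
    have : #|Q :&: S|%SET <= #|S| by rewrite subset_leq_card ?finset.subsetIr.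
    by move: S3; lia.
  apply: (@K5_not_loosely_drawn R).
  apply: (joined_loosely_drawn linkedQ planarS (enum_uniq (mem P)) (sub_enum _ PQ)).
    by move=> e; rewrite P5' !inE; do ![case/orP]; move/eqP->.
  move=> x0 e eE; have [e1 e2 e12] : [/\ e.1 < 5, e.2 < 5 & e.1 != e.2].
    by move: eE; rewrite !inE; do ![case/orP]; move/eqP->.
  have inQ i : i < 5 -> nth x0 (enum P) i \in Q.
    rewrite -P5' => /(mem_nth x0)/(sub_enum _ PQ); rewrite inE => /andP[] //.
  apply: joinP; rewrite ?inQ ?nth_uniq ?enum_uniq ?P5' //.
  move=> w wS wQ; suff : w \in (S :\: Q)%SET by rewrite SQ inE.
  by rewrite inE wQ.
have [A [B [AQ BQ [A3 B3] AB apart]]] := split_points fQ S3 SQ.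
apply: (@K33_not_loosely_drawn R).
have A3' : size (enum A) = 3 by rewrite -cardE.
have B3' : size (enum B) = 3 by rewrite -cardE.
have uAB : uniq (enum A ++ enum B).
  rewrite cat_uniq !enum_uniq andbT /=; apply/hasPn => x; rewrite !mem_enum => xB.
  by apply/negP => xA; move/pred0P: AB => /(_ x) /=; rewrite xA xB.
have sAB : size (enum A ++ enum B) = 6 by rewrite size_cat A3' B3'.
apply: (joined_loosely_drawn linkedQ planarS uAB).
- move=> x; rewrite mem_cat => /orP[]; exact: sub_enum.
- by move=> e; rewrite sAB !inE; do ![case/orP]; move/eqP->.
- move=> x0 e eE; have [e1 e2] : e.1 < 3 /\ 3 <= e.2 < 6.
    by move: eE; rewrite !inE; do ![case/orP]; move/eqP->.
  have /andP[e3 e6] := e2.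
  rewrite !nth_cat A3' e1 ltnNge e3 /=.
  set x := nth x0 (enum A) _; set y := nth x0 (enum B) _.
  have xA : x \in A by rewrite -mem_enum mem_nth ?A3'.
  have yB : y \in B by rewrite -mem_enum mem_nth // B3' ltn_subLR.
  have [xQ yQ] : x \in Q /\ y \in Q.
    have := fintype.subsetP AQ _ xA; have := fintype.subsetP BQ _ yB.
    by rewrite !inE => /andP[_ ->] /andP[_ ->].
  apply: joinP => //.
    by apply/negP => /eqP xy; move/pred0P: AB => /(_ x) /=; rewrite xA xy yB.
  move=> w wS wQ wx wy; case: (apart w wS wQ) => /pred0P.
    by move=> /(_ x) /=; rewrite inE wx xA.
  by move=> /(_ y) /=; rewrite inE wy yB.
Qed.

Theorem theorem6 (R : realType) (G : sgraph) :
  YtriY_family (complete 8) G -> apex_obstruction R 3 G.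
Proof.
move=> /family_full[Q fQ]; split; first exact: full_not_apex fQ.
by move=> H; exact: proper_minor_apex fQ.
Qed.
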